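(* Let $k$ be a commutative field, let $H$ be a connected bialgebra over $k$ and let $A$, $B$ be unital associative $k$-algebras. For $\varphi\in\mathcal U(H,A)$ and $f\in\mathcal U(A^{\mathrm{st}},B)$ put $$T(f,\varphi)=f\circ\varphi^{\mathrm{st}}\circ\iota.$$ Then: (i) $T(f,\varphi)\in\mathcal U(H,B)$, and if $\varphi\in\mathcal C(H,A)$ and $f\in\mathcal C(A^{\mathrm{st}},B)$ then $T(f,\varphi)\in\mathcal C(H,B)$. (ii) For all $f,g\in\mathcal U(A^{\mathrm{st}},B)$ and $\varphi\in\mathcal U(H,A)$, $T(f\ast g,\varphi)=T(f,\varphi)\ast T(g,\varphi)$. (iii) If $A=B$, then $T(j,\varphi)=\varphi$ for all $\varphi\in\mathcal U(H,A)$, where $j\in\mathcal U(A^{\mathrm{st}},A)$ is the linear map with $j(\emptyset)=1_A$, $j(a_1)=a_1$ and $j(a_1\otimes\cdots\otimes a_r)=0$ for $r\ge2$.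
   Context: All vector spaces, algebras and tensor products are over a commutative field $k$; algebras are associative. Connected bialgebras. A bialgebra $(H,m,u,\Delta,\eta)$ is filtered if there are subspaces $H_0\subsetneq H_1\subsetneq\cdots$ with $\bigcup_{n\ge0}H_n=H$, $\Delta H_n\subseteq\sum_{i=0}^n H_i\otimes H_{n-i}$ and $H_nH_m\subseteq H_{n+m}$. It is connected if moreover $H_0=k1_H$. A connected bialgebra is automatically a Hopf algebra. Put $H'=\ker\eta$, so $H=k1_H\oplus H'$, and $p'=\mathrm{Id}-u\circ\eta$. Define $\Delta^{[1]}=\mathrm{Id}$, $\Delta^{[n+1]}=(\mathrm{Id}\otimes\Delta^{[n]})\circ\Delta$, and $\Delta'^{[n]}=p'^{\otimes n}\circ\Delta^{[n]}:H'\to H'^{\otimes n}$ for $n\ge1$. For each $h\in H'$ one has $\Delta'^{[n]}(h)=0$ for $n$ large. Stuffle Hopf algebra. For an associative algebra $A$ (not necessarily unital), $A^{\mathrm{st}}=\bigoplus_{n\ge0}A^{\mathrm{st}}_{(n)}$ with $A^{\mathrm{st}}_{(0)}=k\emptyset$ and $A^{\mathrm{st}}_{(n)}=A^{\otimes n}$ for $n\ge1$; $(A^{\mathrm{st}})'=\bigoplus_{n\ge1}A^{\mathrm{st}}_{(n)}$. The symbol $\otimes$ between letters is the internal (concatenation) tensor product, and $\otimes_{\mathrm{st}}$ denotes the tensor product of elements of $A^{\mathrm{st}}$. The product $m_{\mathrm{st}}$ (stuffle, or quasi-shuffle) has unit $\emptyset$ and is defined recursively, for $\mathbf a=a_1\otimes\cdots\otimes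 a_r$, $\mathbf b=b_1\otimes\cdots\otimes b_s$ ($r,s\ge1$), $\tilde{\mathbf a}=a_1\otimes\cdots\otimes a_{r-1}$ ($=\emptyset$ if $r=1$), $\tilde{\mathbf b}=b_1\otimes\cdots\otimes b_{s-1}$ ($=\emptyset$ if $s=1$), by $$m_{\mathrm{st}}(\mathbf a\otimes_{\mathrm{st}}\mathbf b)=m_{\mathrm{st}}(\tilde{\mathbf a}\otimes_{\mathrm{st}}\mathbf b)\otimes a_r+m_{\mathrm{st}}(\mathbf a\otimes_{\mathrm{st}}\tilde{\mathbf b})\otimes b_s+m_{\mathrm{st}}(\tilde{\mathbf a}\otimes_{\mathrm{st}}\tilde{\mathbf b})\otimes a_rb_s.$$ The counit is $\eta_{\mathrm{st}}(\emptyset)=1$, $\eta_{\mathrm{st}}=0$ on $(A^{\mathrm{st}})'$. The coproduct is deconcatenation: $\Delta_{\mathrm{st}}(\emptyset)=\emptyset\otimes_{\mathrm{st}}\emptyset$ and $\Delta_{\mathrm{st}}(a_1\otimes\cdots\otimes a_s)=\mathbf a\otimes_{\mathrm{st}}\emptyset+\emptyset\otimes_{\mathrm{st}}\mathbf a+\sum_{r=1}^{s-1}(a_1\otimes\cdots\otimes a_r)\otimes_{\mathrm{st}}(a_{r+1}\otimes\cdots\otimes a_s)$. With these, $A^{\mathrm{st}}$ is a connected Hopf algebra. The maps $\iota$ and $\varphi^{\mathrm{st}}$. $\iota:H\to H'^{\mathrm{st}}$ is the linear map with $\iota(1_H)=\emptyset$ and $\iota(h)=\sum_{n\ge1}\Delta'^{[n]}(h)$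 for $h\in H'$, with $\Delta'^{[n]}(h)$ in the length-$n$ component; it is an injective Hopf algebra morphism. For $\varphi\in\mathcal U(H,A)$, $\varphi^{\mathrm{st}}:H'^{\mathrm{st}}\to A^{\mathrm{st}}$ is the linear map with $\varphi^{\mathrm{st}}(\emptyset)=\emptyset$ and $\varphi^{\mathrm{st}}(h_1\otimes\cdots\otimes h_r)=\varphi(h_1)\otimes\cdots\otimes\varphi(h_r)$ for $r\ge1$, $h_i\in H'$. Groups of maps. For a connected bialgebra $K$ (such as $H$ or $A^{\mathrm{st}}$) and a unital algebra $B$, $\mathcal U(K,B)$ is the set of linear maps $f:K\to B$ with $f(1_K)=1_B$, a group under the convolution $f\ast g=m_B\circ(f\otimes g)\circ\Delta_K$ ($m_B$ the product of $B$); $\mathcal C(K,B)\subset\mathcal U(K,B)$ is the subset of unital algebra morphisms (characters). *)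

(* Defs.v *)
From HB Require Import structures.
From mathcomp Require Import all_boot all_order all_algebra.
From mathcomp Require Import boolp classical_sets functions cardinality fsbigop.
From mathcomp Require Import generic_quotient ring_quotient freeg ssrAC zify.

Set Implicit Arguments.
Unset Strict Implicit.
Unset Printing Implicit Defensive.

Import GRing.Theory.
Local Open Scope ring_scope.
Local Open Scope quotient_scope.

Section LinearFor.
Variables (k : fieldType) (U V : lmodType k) (f : U -> V).
Hypothesis f_lin : linear f.

Lemma lin0 : f 0 = 0.
Proof. by rewrite -[0 in LHS](subrr 0) addrC -scaleN1r f_lin scaleN1r addNr. Qed.
Lemma linD x y : f (x + y) = f x + f y.
Proof. by rewrite -[x]scale1r f_lin !scale1r. Qed.
Lemma linZ a x : f (a *: x) = a *: f x.
Proof. by rewrite -[_ *: _]addr0 f_lin lin0 addr0. Qed.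
Lemma lin_sum I (r : seq I) (P : pred I) F :
  f (\sum_(i <- r | P i) F i) = \sum_(i <- r | P i) f (F i).
Proof. by apply: (big_morph f linD lin0). Qed.
End LinearFor.

Lemma linear_comp (k : fieldType) (U V W : lmodType k) (f : U -> V) (g : V -> W) :
  linear f -> linear g -> linear (fun x => g (f x)).
Proof. by move=> fl gl a x y; rewrite fl gl. Qed.

Definition bilin (k : fieldType) (U V W : lmodType k) (b : U -> V -> W) : Prop :=
  (forall v, linear (fun u => b u v)) /\ (forall u, linear (b u)).

Section Quotient.
Variables (k : fieldType) (V : lmodType k) (R : V -> Prop).

(* The k-linear span of R. *)
Inductive lspan : V -> Prop :=
| lspan0 : lspan 0
| lspanS (a : k) (x y : V) of R x & lspan y : lspan (a *: x + y).

Lemma lspan_gen x : R x -> lspan x.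
Proof. by move=> Rx; rewrite -[x]addr0 -[x]scale1r; apply: lspanS Rx lspan0. Qed.

Lemma lspan_lin a x y : lspan x -> lspan y -> lspan (a *: x + y).
Proof.
move=> sx sy; elim: sx => [|b x0 x1 Rx _ IH]; first by rewrite scaler0 add0r.
by rewrite scalerDr scalerA -addrA; apply: lspanS.
Qed.

Definition lspan_pred : {pred V} := fun x => `[< lspan x >].

Lemma lspan_submod : submod_closed lspan_pred.
Proof.
split; first by apply/asboolP; exact: lspan0.
by move=> a x y /asboolP sx /asboolP sy; apply/asboolP; apply: lspan_lin.
Qed.

HB.instance Definition _ := GRing.isSubmodClosed.Build k V lspan_pred lspan_submod.

Local Notation quot := (Quotient.quot lspan_pred).

Definition quotmod : Type := quot.

HB.instance Definition _ := GRing.Zmodule.on quotmod.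

Definition qproj (x : V) : quotmod := \pi_(quot) x.

Lemma qprojP x y : lspan (x - y) <-> qproj x = qproj y.
Proof.
rewrite /qproj; split=> [s | /eqP].
  by apply/eqP; rewrite -Quotient.idealrBE; apply/asboolP.
by rewrite -Quotient.idealrBE => /asboolP.
Qed.

Lemma qprojK (q : quotmod) : qproj (repr (q : quot)) = q.
Proof. exact: reprK. Qed.

Lemma qprojD x y : qproj (x + y) = qproj x + qproj y.
Proof. by rewrite /qproj piE. Qed.

Definition qscale (a : k) (q : quotmod) : quotmod :=
  qproj (a *: repr (q : quot)).

Lemma qscaleE a x : qscale a (qproj x) = qproj (a *: x).
Proof.
apply/qprojP; rewrite -scalerBr -[_ *: _]addr0; apply: lspan_lin lspan0.
by apply/qprojP; rewrite qprojK.
Qed.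

Lemma qscaleA a b q : qscale a (qscale b q) = qscale (a * b) q.
Proof. by rewrite -[q]qprojK !qscaleE scalerA. Qed.
Lemma qscale1 : left_id 1 qscale.
Proof. by move=> q; rewrite -[q]qprojK qscaleE scale1r. Qed.
Lemma qscaleDr : right_distributive qscale +%R.
Proof.
by move=> a p q; rewrite -[p]qprojK -[q]qprojK -qprojD !qscaleE scalerDr qprojD.
Qed.
Lemma qscaleDl q : {morph qscale^~ q : a b / a + b}.
Proof. by move=> a b; rewrite -[q]qprojK !qscaleE scalerDl qprojD. Qed.

HB.instance Definition _ := GRing.Zmodule_isLmodule.Build k quotmod
  qscaleA qscale1 qscaleDr qscaleDl.

Lemma qproj_linear : linear qproj.
Proof. by move=> a x y; rewrite qprojD -qscaleE. Qed.
HB.instance Definition _ := GRing.isLinear.Build k V quotmod *:%R qproj qproj_linear.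

End Quotient.

Section Presented.
Variables (k : fieldType) (X : choiceType) (R : {freeg X / k} -> Prop).

Definition presented : Type := quotmod R.
HB.instance Definition _ := GRing.Lmodule.on presented.

Definition gen (x : X) : presented := qproj R << x >>.

Definition plift (U : lmodType k) (F : X -> U) (q : presented) : U :=
  fglift F (repr (q : Quotient.quot (lspan_pred R))).

Lemma freeg_scaleU (a b : k) (x : X) :
  a *: << b *g x >> = << a * b *g x >> :> {freeg X / k}.
Proof. by apply/eqP/freeg_eqP => y; rewrite coeffZ !coeffU mulrA. Qed.

Lemma freeg_ind (P : {freeg X / k} -> Prop) :
  P 0 -> (forall a x D, P D -> P (<< a *g x >> + D)) -> forall D, P D.
Proof.
move=> P0 PS D; rewrite -[D]freeg_sumE.
elim: (dom D) => [|x s IH]; first by rewrite big_nil.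
by rewrite big_cons; apply: PS.
Qed.

Lemma presented_ind (P : presented -> Prop) :
  P 0 -> (forall a x q, P q -> P (a *: gen x + q)) -> forall q, P q.
Proof.
move=> P0 PS q; rewrite -[q]qprojK; elim/freeg_ind: (repr _) => [|a x D IH].
  by rewrite linear0.
by rewrite linearD -[a in << a *g _ >>]mulr1 -freeg_scaleU linearZ; apply: PS.
Qed.

Lemma presented_eq (U : lmodType k) (f g : presented -> U) :
  linear f -> linear g -> (forall x, f (gen x) = g (gen x)) -> f =1 g.
Proof.
move=> fl gl fg; elim/presented_ind => [|a x q IH]; first by rewrite !lin0.
by rewrite fl gl IH fg.
Qed.

Section Lift.
Variables (U : lmodType k) (F : X -> U).

HB.instance Definition _ :=
  GRing.isZmodMorphism.Build {freeg X / k} U (fglift F) (lift_is_additive F).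

Lemma fglift_linear : linear (fglift F).
Proof.
move=> a x y; rewrite raddfD /=; congr (_ + _).
elim/freeg_ind: x => [|b z x IH].
  have -> : a *: 0 = 0 :> {freeg X / k} by exact: scaler0.
  by rewrite raddf0 scaler0.
have -> : a *: (<< b *g z >> + x) = << a * b *g z >> + a *: x :> {freeg X / k}.
  by rewrite -freeg_scaleU; exact: scalerDr.
by rewrite !raddfD /= IH !liftU scalerA.
Qed.

Hypothesis F_R : forall r, R r -> fglift F r = 0.

Lemma fglift_span r : lspan R r -> fglift F r = 0.
Proof.
elim=> [|a x y /F_R Fx _ Fy]; first exact: raddf0.
by rewrite fglift_linear Fx Fy scaler0 addr0.
Qed.

Lemma plift_proj x : plift F (qproj R x) = fglift F x.
Proof.
apply/eqP; rewrite /plift -subr_eq0 -raddfB; apply/eqP/fglift_span.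
by apply/qprojP; rewrite qprojK.
Qed.

Lemma plift_gen x : plift F (gen x) = F x.
Proof. by rewrite plift_proj liftU scale1r. Qed.

Lemma plift_linear : linear (plift F).
Proof.
move=> a p q; rewrite -[p]qprojK -[q]qprojK -linearP !plift_proj.
exact: fglift_linear.
Qed.
End Lift.
End Presented.

Section FgliftLinear.
Variables (k : fieldType) (X : choiceType) (U : lmodType k) (F : X -> U).
HB.instance Definition _ := GRing.isScalable.Build k {freeg X / k} U *:%R
  (fglift F) (scalable_linear (fglift_linear F)).
End FgliftLinear.

Section Tensor.
Variables (k : fieldType) (V W : lmodType k).

(* V (x) W is the free vector space on V * W modulo the two families of       *)
(* bilinearity relators.                                                       *)
Inductive tensor_rel : {freeg (V * W)%type / k} -> Prop :=
| tensor_rell a v v' w :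
    tensor_rel (<< (a *: v + v', w) >> - (a *: << (v, w) >> + << (v', w) >>))
| tensor_relr a v w w' :
    tensor_rel (<< (v, a *: w + w') >> - (a *: << (v, w) >> + << (v, w') >>)).

Definition tensor : Type := presented tensor_rel.
HB.instance Definition _ := GRing.Lmodule.on tensor.

Definition tpure (v : V) (w : W) : tensor := gen tensor_rel (v, w).

Lemma tpure_bilin : bilin tpure.
Proof.
split=> [w a v v' | v a w w'] /=; rewrite /tpure /gen -linearP; apply/qprojP;
  apply: lspan_gen; [exact: tensor_rell | exact: tensor_relr].
Qed.

(* tlift b is total in b; it is the linear map v (x) w |-> b v w of the       *)
(* universal property exactly when b is bilinear (tliftE, tlift_linear).       *)
Definition tlift (U : lmodType k) (b : V -> W -> U) : tensor -> U :=
  plift (fun p => b p.1 p.2).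

Section Lift.
Variables (U : lmodType k) (b : V -> W -> U).
Hypothesis b_bilin : bilin b.

Lemma tlift_rel r : tensor_rel r -> fglift (fun p => b p.1 p.2) r = 0.
Proof.
case=> [a v v' w | a v w w']; rewrite linearB linearP /= !liftU !scale1r /=.
  by rewrite b_bilin.1 subrr.
by rewrite b_bilin.2 subrr.
Qed.

Lemma tliftE v w : tlift b (tpure v w) = b v w.
Proof. by rewrite /tlift plift_gen //; exact: tlift_rel. Qed.

Lemma tlift_linear : linear (tlift b).
Proof. by apply: plift_linear; exact: tlift_rel. Qed.
End Lift.

Lemma tensor_ind (P : tensor -> Prop) :
  P 0 -> (forall v w t, P t -> P (tpure v w + t)) -> forall t, P t.
Proof.
move=> P0 PS; apply: presented_ind => // a [v w] t Pt.
have -> : a *: gen tensor_rel (v, w) = tpure (a *: v) w.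
  by rewrite -(linZ (tpure_bilin.1 w)).
exact: PS.
Qed.

Lemma tensor_eq (U : lmodType k) (f g : tensor -> U) :
  linear f -> linear g -> (forall v w, f (tpure v w) = g (tpure v w)) -> f =1 g.
Proof. by move=> fl gl fg; apply: presented_eq => // -[]. Qed.

End Tensor.

Notation "v \ox w" := (tpure v w) (at level 40, left associativity) : ring_scope.

Section TensorMaps.
Variable k : fieldType.

Lemma bilin_comp (U V W X : lmodType k) (b : U -> V -> W) (f : W -> X) :
  bilin b -> linear f -> bilin (fun u v => f (b u v)).
Proof.
by move=> [bl br] fl; split=> [w|v]; apply: linear_comp fl; [exact: bl|exact: br].
Qed.

Lemma bilin_pre (U U' V V' W : lmodType k) (b : U -> V -> W) (f : U' -> U) (g : V' -> V) :
  bilin b -> linear f -> linear g -> bilin (fun u v => b (f u) (g v)).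
Proof.
by move=> [bl br] fl gl; split=> [w|v] a x y /=; rewrite (fl, gl) (bl, br).
Qed.

Lemma bilin_flip (U V W : lmodType k) (b : U -> V -> W) :
  bilin b -> bilin (fun v u => b u v).
Proof. by case. Qed.

Lemma tlift_param (U V W X : lmodType k) (F : U -> V -> W -> X) :
  (forall u, bilin (F u)) -> (forall v w, linear (fun u => F u v w)) ->
  bilin (fun u => tlift (F u)).
Proof.
move=> Fb Fl; split=> [t a u u' | u]; last exact: tlift_linear.
elim/tensor_ind: t => [|v w t IH].
  rewrite !(lin0 (tlift_linear (Fb _))). by rewrite scaler0 addr0.
rewrite !(linD (tlift_linear (Fb _))) IH !tliftE // Fl scalerDr.
by rewrite !addrA; congr (_ + _); rewrite addrAC.
Qed.

Definition tmap (V V' W W' : lmodType k) (f : V -> V') (g : W -> W') :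
  tensor V W -> tensor V' W' := tlift (fun v w => f v \ox g w).

Lemma tmap_bilin (V V' W W' : lmodType k) (f : V -> V') (g : W -> W') :
  linear f -> linear g -> bilin (fun v w => f v \ox g w).
Proof. by move=> fl gl; apply: (bilin_pre (tpure_bilin _ _)). Qed.

Definition tassoc (U V W : lmodType k) :
    tensor (tensor U V) W -> tensor U (tensor V W) :=
  tlift (fun t w => tlift (fun u v => u \ox (v \ox w)) t).

Lemma tassoc_bilin (U V W : lmodType k) :
  bilin (fun (t : tensor U V) (w : W) => tlift (fun u v => u \ox (v \ox w)) t).
Proof.
apply: bilin_flip.
apply: (@tlift_param W U V _ (fun w' u' v' => u' \ox (v' \ox w'))) => [w|u v].
  by apply: (bilin_pre (tpure_bilin _ _)) => //; exact: (tpure_bilin _ _).1.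
by move=> a x y /=; rewrite (tpure_bilin _ _).2 (tpure_bilin _ _).2.
Qed.

Lemma tassoc_linear (U V W : lmodType k) : linear (@tassoc U V W).
Proof. exact/tlift_linear/tassoc_bilin. Qed.

Lemma tassocE (U V W : lmodType k) (u : U) (v : V) (w : W) :
  tassoc (u \ox v \ox w) = u \ox (v \ox w).
Proof.
rewrite /tassoc tliftE ?tliftE //; last exact: tassoc_bilin.
by apply: (bilin_pre (tpure_bilin _ _)) => //; exact: (tpure_bilin _ _).1.
Qed.

End TensorMaps.

Section Words.
Variables (k : fieldType) (V : lmodType k).

(* st V is the direct sum of all tensor powers of V, with V^{(x)0} = k: the    *)
(* free vector space on the words over V modulo linearity in each letter.      *)
(* The relators are homogeneous in the length, so the words of length n span   *)
(* the summand V^{(x)n}; word [::] is the empty word, word [:: a1; ...; an]    *)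
(* is a1 (x) ... (x) an.                                                       *)
Inductive word_rel : {freeg (seq V) / k} -> Prop :=
| word_rel_letter a s v v' t :
    word_rel (<< s ++ (a *: v + v') :: t >>
              - (a *: << s ++ v :: t >> + << s ++ v' :: t >>)).

Definition st : Type := presented word_rel.
HB.instance Definition _ := GRing.Lmodule.on st.

Definition word (s : seq V) : st := gen word_rel s.

Definition multilin (U : lmodType k) (F : seq V -> U) : Prop :=
  forall s t, linear (fun v => F (s ++ v :: t)).

Lemma word_multilin : multilin word.
Proof.
move=> s t a v v'; rewrite /word /gen -linearP; apply/qprojP.
by apply: lspan_gen; exact: word_rel_letter.
Qed.

(* As for tlift: meaningful when F is linear in each letter of its argument.   *)
Definition wlift (U : lmodType k) (F : seq V -> U) : st -> U := plift F.

Section Lift.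
Variables (U : lmodType k) (F : seq V -> U).
Hypothesis F_multilin : multilin F.

Lemma wlift_rel r : word_rel r -> fglift F r = 0.
Proof.
case=> a s v v' t; rewrite linearB linearP /= !liftU !scale1r.
by rewrite F_multilin subrr.
Qed.

Lemma wliftE s : wlift F (word s) = F s.
Proof. by rewrite /wlift plift_gen //; exact: wlift_rel. Qed.

Lemma wlift_linear : linear (wlift F).
Proof. by apply: plift_linear; exact: wlift_rel. Qed.
End Lift.

Lemma st_ind (P : st -> Prop) :
  P 0 -> (forall a s x, P x -> P (a *: word s + x)) -> forall x, P x.
Proof. exact: presented_ind. Qed.

Lemma st_eq (U : lmodType k) (f g : st -> U) :
  linear f -> linear g -> (forall s, f (word s) = g (word s)) -> f =1 g.
Proof. exact: presented_eq. Qed.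

Lemma wlift_param (T U : lmodType k) (F : T -> seq V -> U) :
  (forall u, multilin (F u)) -> (forall s, linear (fun u => F u s)) ->
  bilin (fun u => wlift (F u)).
Proof.
move=> Fm Fl; split=> [x a u u' | u]; last exact: wlift_linear.
elim/st_ind: x => [|b s x IH].
  by rewrite !(lin0 (wlift_linear (Fm _))) scaler0 addr0.
rewrite !(wlift_linear (Fm _)) IH !wliftE // Fl !scalerDr !scalerA mulrC.
by rewrite !addrA; congr (_ + _); rewrite addrAC.
Qed.

Lemma word0 s t : word (s ++ 0 :: t) = 0.
Proof. exact: (lin0 (word_multilin s t)). Qed.

End Words.

Section WordMaps.
Variable k : fieldType.

Definition wmap (V W : lmodType k) (f : V -> W) : st V -> st W :=
  wlift (fun s => word (map f s)).

Lemma wmap_multilin (V W : lmodType k) (f : V -> W) :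
  linear f -> multilin (fun s => word (map f s)).
Proof.
by move=> fl s t a v v' /=; rewrite !map_cat /= fl (word_multilin _ _).
Qed.

HB.instance Definition _ (V W : lmodType k) (f : {linear V -> W}) :=
  GRing.isLinear.Build k (st V) (st W) *:%R (wmap f)
    (wlift_linear (wmap_multilin (@linearP _ _ _ _ f))).

(* wcons v : x |-> v (x) x and wrcons x v = x (x) v, for the internal product. *)
Definition wcons (V : lmodType k) (v : V) : st V -> st V :=
  wlift (fun s => word (v :: s)).

Definition wrcons (V : lmodType k) (x : st V) (v : V) : st V :=
  wlift (fun s => word (rcons s v)) x.

Lemma wcons_bilin (V : lmodType k) : bilin (@wcons V).
Proof.
apply: wlift_param => [v s t a x y | s a x y]; last exact: (word_multilin nil).
by rewrite -!cat_cons (word_multilin (v :: s)).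
Qed.

Lemma wconsE (V : lmodType k) (v : V) s : wcons v (word s) = word (v :: s).
Proof.
by rewrite /wcons wliftE // => s' t a x y; rewrite -!cat_cons (word_multilin _ _).
Qed.

Lemma rcons_multilin (V : lmodType k) (v : V) :
  multilin (fun s => word (rcons s v)).
Proof. by move=> s t a x y; rewrite !rcons_cat /= (word_multilin _ _). Qed.

Lemma wrconsE (V : lmodType k) (v : V) s : wrcons (word s) v = word (rcons s v).
Proof. by rewrite /wrcons wliftE //; exact: rcons_multilin. Qed.

Lemma wrcons_bilin (V : lmodType k) : bilin (@wrcons V).
Proof.
apply/bilin_flip/(@wlift_param _ _ _ _ (fun v s => word (rcons s v))).
  exact: rcons_multilin.
by move=> s a x y; rewrite -!cats1 (word_multilin _ _).
Qed.

End WordMaps.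

(* Associative algebras without a unit, then with a unit. The library's        *)
(* algType requires 1 != 0; the zero algebra is allowed here, and every        *)
(* algType is an instance (see LibraryAlgebra below).                          *)
HB.mixin Record isAssocAlgebra (k : fieldType) A of GRing.Lmodule k A := {
  amul : A -> A -> A;
  amulA : associative amul;
  amul_bilin : bilin amul;
}.

#[short(type="assocAlgType")]
HB.structure Definition AssocAlgebra (k : fieldType) :=
  {A of GRing.Lmodule k A & isAssocAlgebra k A}.

Notation "x ** y" := (amul x y) (at level 40, left associativity) : ring_scope.

HB.mixin Record hasUnit (k : fieldType) A of AssocAlgebra k A := {
  aone : A;
  amul1l : left_id aone (amul : A -> A -> A);
  amul1r : right_id aone (amul : A -> A -> A);
}.

#[short(type="unitalAlgType")]
HB.structure Definition UnitalAlgebra (k : fieldType) :=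
  {A of AssocAlgebra k A & hasUnit k A}.

Section LibraryAlgebra.
Variables (k : fieldType) (A : algType k).

Lemma algType_mul_bilin : bilin ( *%R : A -> A -> A).
Proof.
split=> [y a x x' | x a y y'] /=; first by rewrite mulrDl scalerAl.
by rewrite mulrDr scalerAr.
Qed.

HB.instance Definition _ :=
  isAssocAlgebra.Build k (GRing.Algebra.sort A) (@mulrA A) algType_mul_bilin.
HB.instance Definition _ :=
  hasUnit.Build k (GRing.Algebra.sort A) (@mul1r A) (@mulr1 A).
End LibraryAlgebra.

HB.mixin Record isCoalgebra (k : fieldType) C of GRing.Lmodule k C := {
  comul : C -> tensor C C;
  counit : C -> k;
  comul_linear : linear comul;
  counit_linear : scalar counit;
  comulA : forall c, tassoc (tmap comul idfun (comul c)) = tmap idfun comul (comul c);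
  counitl : forall c, tlift (fun x y => counit x *: y) (comul c) = c;
  counitr : forall c, tlift (fun x y => counit y *: x) (comul c) = c;
}.

#[short(type="coalgType")]
HB.structure Definition Coalgebra (k : fieldType) :=
  {C of GRing.Lmodule k C & isCoalgebra k C}.

HB.instance Definition _ (k : fieldType) (C : coalgType k) :=
  GRing.isLinear.Build k C (tensor C C) *:%R comul comul_linear.
HB.instance Definition _ (k : fieldType) (C : coalgType k) :=
  GRing.isLinear.Build k C k *%R counit counit_linear.

(* (a (x) b)(a' (x) b') = aa' (x) bb'. *)
Definition tmul (k : fieldType) (A B : assocAlgType k) (s t : tensor A B) : tensor A B :=
  tlift (fun a b => tlift (fun a' b' => (a ** a') \ox (b ** b')) t) s.

HB.mixin Record isBialgebra (k : fieldType) H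
    of UnitalAlgebra k H & Coalgebra k H := {
  comul1 : comul (aone : H) = aone \ox aone;
  comulM : forall x y : H, comul (x ** y) = tmul (comul x) (comul y);
  counit1 : counit (aone : H) = 1;
  counitM : forall x y : H, counit (x ** y) = counit x * counit y;
}.

#[short(type="bialgType")]
HB.structure Definition Bialgebra (k : fieldType) :=
  {H of UnitalAlgebra k H & Coalgebra k H & isBialgebra k H}.

Section Stuffle.
Variables (k : fieldType) (A : assocAlgType k).
Implicit Types (s t u : seq A) (x y z : st A).

(* The stuffle recursion peels off last letters, hence runs on reversed words;  *)
(* stuffle_wordE is the recursion on the words themselves.                     *)
Fixpoint stuffle_rev (s : seq A) : seq A -> st A :=
  fix stuffle_s (t : seq A) : st A :=
    match s, t with
    | [::], _ => word (rev t)
    | _, [::] => word (rev s)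
    | a :: s', b :: t' =>
        wrcons (stuffle_rev s' t) a + wrcons (stuffle_s t') b
        + wrcons (stuffle_rev s' t') (a ** b)
    end.

Definition stuffle_word (s t : seq A) : st A := stuffle_rev (rev s) (rev t).

Definition st_mul (x y : st A) : st A :=
  wlift (fun s => wlift (stuffle_word s) y) x.

Lemma stuffle_rev0s t : stuffle_rev [::] t = word (rev t).
Proof. by case: t. Qed.
Lemma stuffle_revs0 s : stuffle_rev s [::] = word (rev s).
Proof. by case: s. Qed.

Lemma stuffle_wordE s t a b :
  stuffle_word (rcons s a) (rcons t b) =
    wrcons (stuffle_word s (rcons t b)) a + wrcons (stuffle_word (rcons s a) t) b
    + wrcons (stuffle_word s t) (a ** b).
Proof. by rewrite /stuffle_word !rev_rcons. Qed.
Lemma stuffle_word0s t : stuffle_word [::] t = word t.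
Proof. by rewrite /stuffle_word stuffle_rev0s revK. Qed.
Lemma stuffle_words0 s : stuffle_word s [::] = word s.
Proof. by rewrite /stuffle_word stuffle_revs0 revK. Qed.

Lemma rev_multilin (F : seq A -> st A) :
  multilin F -> multilin (fun s => F (rev s)).
Proof. by move=> Fm s t a x y; rewrite !rev_cat !rev_cons -!cats1 -!catA /= Fm. Qed.

Lemma word_rev_multilin : multilin (fun s : seq A => word (rev s)).
Proof. exact/rev_multilin/word_multilin. Qed.

Lemma wr_lin (f : A -> st A) (v : A) : linear f -> linear (fun c => wrcons (f c) v).
Proof. by move=> fl; apply: linear_comp fl ((wrcons_bilin A).1 v). Qed.

Lemma linear_add (U V : lmodType k) (f g : U -> V) : linear f -> linear g -> linear (fun c => f c + g c).
Proof. by move=> fl gl a x y; rewrite fl gl scalerDr addrACA. Qed.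

Lemma stuffle_rev_multilin_l t : multilin (fun s => stuffle_rev s t).
Proof.
move=> s1 s2; elim: s1 t => [|c s1 IH].
  elim=> [|b t IHt] /=; first exact: (word_rev_multilin [::]).
  apply: linear_add; first apply: linear_add.
  - exact: (wrcons_bilin A).2.
  - exact: wr_lin.
  - by move=> a x y; rewrite (@amul_bilin k A).1 (wrcons_bilin A).2.
elim=> [|b t IHt]; first exact: (word_rev_multilin (c :: s1)).
by apply: linear_add; first apply: linear_add; apply: wr_lin.
Qed.

Lemma stuffle_rev_multilin_r s : multilin (stuffle_rev s).
Proof.
move=> t1 t2; elim: s t1 => [|c s IH] t1.
  move=> a x y; rewrite !stuffle_rev0s; exact: word_rev_multilin.
elim: t1 => [|b t1 IHt] /=.
  apply: linear_add; first apply: linear_add.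
  - exact: wr_lin (IH [::]).
  - exact: (wrcons_bilin A).2.
  - by move=> a x y; rewrite (@amul_bilin k A).2 (wrcons_bilin A).2.
apply: linear_add; first apply: linear_add; apply: wr_lin => //.
exact: (IH (b :: t1)).
Qed.

Lemma stuffle_multilin_r s : multilin (stuffle_word s).
Proof. exact/rev_multilin/stuffle_rev_multilin_r. Qed.
Lemma stuffle_multilin_l t : multilin (fun s => stuffle_word s t).
Proof. exact/(rev_multilin (stuffle_rev_multilin_l _)). Qed.

Lemma st_mul_bilin : bilin st_mul.
Proof.
apply/bilin_flip/(@wlift_param _ _ _ _ (fun y s => wlift (stuffle_word s) y)).
  move=> y s t; apply: (wlift_param _ _).1 => [v | s'].
    exact: stuffle_multilin_r.
  exact: stuffle_multilin_l.
by move=> s; apply/wlift_linear/stuffle_multilin_r.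
Qed.

Lemma st_mulE s t : st_mul (word s) (word t) = stuffle_word s t.
Proof.
rewrite /st_mul wliftE ?wliftE //; first exact: stuffle_multilin_r.
move=> s1 s2; apply: (wlift_param _ _).1 => [v | s'].
  exact: stuffle_multilin_r.
exact: stuffle_multilin_l.
Qed.

Local Notation M := st_mul.
Local Notation wr := wrcons.

Lemma st_mul_rcons x y a b :
  M (wr x a) (wr y b) = wr (M x (wr y b)) a + wr (M (wr x a) y) b + wr (M x y) (a ** b).
Proof.
have ML := st_mul_bilin.1; have MR := st_mul_bilin.2; have W := (wrcons_bilin A).1.
have WM c (f : st A -> st A) : linear f -> linear (fun x => wr (f x) c).
  by move=> fl; apply: linear_comp fl (W c).
move: x; apply: st_eq => [|| s].
- exact: linear_comp (W a) (ML _).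
- do !apply: linear_add; apply: WM => //; exact: linear_comp (W a) (ML _).
move: y; apply: st_eq => [|| t].
- exact: linear_comp (W b) (MR _).
- do !apply: linear_add; apply: WM => //; exact: linear_comp (W b) (MR _).
by rewrite !wrconsE !st_mulE stuffle_wordE.
Qed.

Lemma st_mul1l x : M (word [::]) x = x.
Proof.
move: x; apply: st_eq => [||t]; [exact: st_mul_bilin.2 | by [] |].
by rewrite st_mulE stuffle_word0s.
Qed.

Lemma st_mul1r x : M x (word [::]) = x.
Proof.
move: x; apply: st_eq => [||t]; [exact: st_mul_bilin.1 | by [] |].
by rewrite st_mulE stuffle_words0.
Qed.

Lemma st_mulA_word s t u :
  M (word s) (M (word t) (word u)) = M (M (word s) (word t)) (word u).
Proof.
have ML := st_mul_bilin.1; have MR := st_mul_bilin.2; have W := (wrcons_bilin A).1.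
have [n] := ubnP (size s + size t + size u).
elim: n s t u => // n IH s t u.
case/lastP: s => [|s a]; first by rewrite !st_mul1l.
case/lastP: t => [|t b]; first by rewrite st_mul1l st_mul1r.
case/lastP: u => [|u c]; first by rewrite !st_mul1r.
rewrite !size_rcons => lt_n.
have := IH s (rcons t b) (rcons u c); have := IH (rcons s a) t (rcons u c).
have := IH (rcons s a) (rcons t b) u; have := IH s t (rcons u c).
have := IH s (rcons t b) u; have := IH (rcons s a) t u; have := IH s t u.
rewrite !size_rcons -!wrconsE.
move=> /(_ ltac:(lia)) I7 /(_ ltac:(lia)) I6 /(_ ltac:(lia)) I5 /(_ ltac:(lia)) I4.
move=> /(_ ltac:(lia)) I3 /(_ ltac:(lia)) I2 /(_ ltac:(lia)) I1.
rewrite [M (wr _ b) (wr _ c)]st_mul_rcons [M (wr _ a) (wr _ b)]st_mul_rcons.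
rewrite !(linD (MR _)) !(linD (ML _)) !st_mul_rcons.
rewrite I2 I3 I4 I5 I6 I7 !amulA.
move: I1; rewrite [M (wr _ b) (wr _ c)]st_mul_rcons !(linD (MR _)) => I1.
rewrite [M (wr _ a) (wr _ b)]st_mul_rcons !(linD (ML _)) !(linD (W _)).
rewrite [LHS](AC (3*3*3) ((1*4*7)*2*3*5*6*8*9)) /= -!(linD (W _)) I1.
by rewrite !(linD (W _)) [RHS](AC (3*3*3) (1*4*7*(2*5*8)*3*6*9)).
Qed.

Lemma st_mulA : associative M.
Proof.
have ML := st_mul_bilin.1; have MR := st_mul_bilin.2 => x y z.
move: x; apply: st_eq => [|| s]; [exact: ML | exact: linear_comp (ML _) (ML _) |].
move: y; apply: st_eq => [|| t].
- exact: linear_comp (ML _) (MR _).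
- exact: linear_comp (MR _) (ML _).
move: z; apply: st_eq => [|| u]; [exact: linear_comp (MR _) (MR _) | exact: MR |].
exact: st_mulA_word.
Qed.

HB.instance Definition _ := isAssocAlgebra.Build k (st A) st_mulA st_mul_bilin.
HB.instance Definition _ := hasUnit.Build k (st A) st_mul1l st_mul1r.

End Stuffle.

Section Deconcatenation.
Variables (k : fieldType) (V : lmodType k).
Implicit Types (s t : seq V) (x y : st V).

(* The terms i = 0 and i = size s are (empty word) (x) s and s (x) (empty word). *)
Definition deconc s : tensor (st V) (st V) :=
  \sum_(i < (size s).+1) word (take i s) \ox word (drop i s).

Definition st_comul : st V -> tensor (st V) (st V) := wlift deconc.

Definition st_counit : st V -> k := wlift (fun s => (s == [::])%:R : k^o).

Lemma deconc_multilin : multilin deconc.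
Proof.
move=> s t a v v'; rewrite /deconc !size_cat /= scaler_sumr -big_split /=.
apply: eq_bigr => i _; rewrite !take_cat !drop_cat; case: ltnP => [_|le_si].
  by rewrite word_multilin (tpure_bilin _ _).2.
case: (i - size s)%N => [|j] /=.
  by rewrite (word_multilin [::]) (tpure_bilin _ _).2.
by rewrite word_multilin (tpure_bilin _ _).1.
Qed.

Lemma counit_multilin : multilin (fun s => (s == [::])%:R : k^o).
Proof. by move=> [|c s] t a v v' /=; rewrite scaler0 addr0. Qed.

Lemma st_comul_linear : linear st_comul.
Proof. exact/wlift_linear/deconc_multilin. Qed.
Lemma st_comulE s : st_comul (word s) = deconc s.
Proof. exact/wliftE/deconc_multilin. Qed.
Lemma st_counit_linear : scalar st_counit.
Proof. exact/(wlift_linear counit_multilin). Qed.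
Lemma st_counitE s : st_counit (word s) = (s == [::])%:R.
Proof. exact/(wliftE counit_multilin). Qed.

Lemma idfun_linear (U : lmodType k) : linear (@idfun U).
Proof. by []. Qed.

Lemma tmap_linear (U U' W W' : lmodType k) (f : U -> U') (g : W -> W') :
  linear f -> linear g -> linear (tmap f g).
Proof. by move=> fl gl; apply/tlift_linear/tmap_bilin. Qed.

Lemma tmapE (U U' W W' : lmodType k) (f : U -> U') (g : W -> W') u w :
  linear f -> linear g -> tmap f g (u \ox w) = f u \ox g w.
Proof. by move=> fl gl; rewrite /tmap tliftE //; apply: tmap_bilin. Qed.

Let idl := @idfun_linear.

Lemma st_comul_nil : st_comul (word [::]) = word [::] \ox word [::].
Proof. by rewrite st_comulE /deconc big_ord1. Qed.

Lemma st_comul_cons v x :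
  st_comul (wcons v x) =
    word [::] \ox wcons v x + tmap (wcons v) idfun (st_comul x).
Proof.
have Wl := (wcons_bilin V).2 v; have cl := st_comul_linear.
have tl := tmap_linear Wl (@idl (st V)).
move: x; apply: st_eq => [|| s].
- exact: linear_comp Wl cl.
- apply: linear_add; last exact: linear_comp cl tl.
  exact: linear_comp Wl ((tpure_bilin _ _).2 _).
rewrite wconsE !st_comulE /deconc /= big_ord_recl /=; congr (_ + _).
by rewrite (lin_sum tl); apply: eq_bigr => i _; rewrite tmapE // wconsE.
Qed.

Lemma st_comul_rcons x v :
  st_comul (wrcons x v) =
    tmap idfun (fun y => wrcons y v) (st_comul x) + wrcons x v \ox word [::].
Proof.
have Wl := (wrcons_bilin V).1 v; have cl := st_comul_linear.
have tl := tmap_linear (@idl (st V)) Wl.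
move: x; apply: st_eq => [|| s].
- exact: linear_comp Wl cl.
- apply: linear_add; first exact: linear_comp cl tl.
  exact: linear_comp Wl ((tpure_bilin _ _).1 _).
rewrite wrconsE !st_comulE /deconc /= size_rcons big_ord_recr /=; congr (_ + _); last first.
  by rewrite -(size_rcons s v) take_size drop_size.
rewrite (lin_sum tl); apply: eq_bigr => i _; rewrite tmapE // wrconsE.
have le_is : (i <= size s)%N by rewrite -ltnS.
by rewrite drop_rcons // -cats1 takel_cat.
Qed.

Lemma st_comulA x :
  tassoc (tmap st_comul idfun (st_comul x)) = tmap idfun st_comul (st_comul x).
Proof.
have cl := st_comul_linear; have T U W := @tpure_bilin k U W.
have tA := @tassoc_linear k (st V) (st V) (st V).
have tL := tmap_linear cl (@idl (st V)); have tR := tmap_linear (@idl (st V)) cl.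
move: x; apply: st_eq => [|| s].
- exact: linear_comp cl (linear_comp tL tA).
- exact: linear_comp cl tR.
elim: s => [|v s IH].
  by rewrite st_comul_nil !tmapE // st_comul_nil tassocE.
have Wl := (wcons_bilin V).2 v; have tW := tmap_linear Wl (@idl (st V)).
have tW' := tmap_linear Wl (@idl (tensor (st V) (st V))).
rewrite -wconsE st_comul_cons (linD tL) (linD tR) (linD tA) !tmapE //.
rewrite st_comul_nil tassocE st_comul_cons (linD ((T _ _).2 _)) -addrA; congr (_ + _).
suff key (r : tensor (st V) (st V)) : tassoc (tmap st_comul idfun (tmap (wcons v) idfun r)) =
    word [::] \ox tmap (wcons v) idfun r
    + tmap (wcons v) idfun (tassoc (tmap st_comul idfun r)).
  rewrite key IH; congr (_ + _); move: (st_comul _).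
  apply: tensor_eq => [||x y]; [exact: linear_comp tR tW'|exact: linear_comp tW tR|].
  by rewrite !tmapE.
move: r; apply: tensor_eq => [||x y].
- exact: linear_comp tW (linear_comp tL tA).
- apply: linear_add; first exact: linear_comp tW ((T _ _).2 _).
  exact: linear_comp tL (linear_comp tA tW').
rewrite !tmapE // st_comul_cons (linD ((T _ _).1 _)) (linD tA) tassocE; congr (_ + _).
move: (st_comul x); apply: tensor_eq => [||x1 x2].
- exact: linear_comp tW (linear_comp ((T _ _).1 _) tA).
- exact: linear_comp ((T _ _).1 _) (linear_comp tA tW').
by rewrite tmapE // !tassocE tmapE.
Qed.

Lemma st_counit_cons v x : st_counit (wcons v x) = 0.
Proof.
move: x; apply: (@st_eq _ _ k^o) => [|| s].
- exact: (@linear_comp _ _ _ k^o _ _ ((wcons_bilin V).2 v) st_counit_linear).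
- by move=> a x y; rewrite scaler0 addr0.
by rewrite wconsE st_counitE.
Qed.

Lemma st_counit_rcons v x : st_counit (wrcons x v) = 0.
Proof.
move: x; apply: (@st_eq _ _ k^o) => [|| s].
- exact: (@linear_comp _ _ _ k^o _ _ ((wrcons_bilin V).1 v) st_counit_linear).
- by move=> a x y; rewrite scaler0 addr0.
by rewrite wrconsE st_counitE; case: s.
Qed.

Lemma st_counitl x : tlift (fun x y => st_counit x *: y) (st_comul x) = x.
Proof.
have bl : bilin (fun x y : st V => st_counit x *: y).
  split=> [z a u w | u a z w].
    by rewrite st_counit_linear scalerDl scalerA.
  by rewrite scalerDr !scalerA mulrC.
have ll := tlift_linear bl; have cl := st_comul_linear.
move: x; apply: st_eq => [|| s] //; first exact: linear_comp cl ll.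
case: s => [|v s].
  by rewrite st_comul_nil tliftE // st_counitE scale1r.
rewrite -wconsE st_comul_cons (linD ll) tliftE // st_counitE scale1r.
rewrite -[RHS]addr0; congr (_ + _); move: (st_comul _).
have tW := tmap_linear ((wcons_bilin V).2 v) (@idl (st V)).
apply: tensor_eq => [||x y]; first exact: linear_comp tW ll.
  by move=> a x y; rewrite scaler0 addr0.
rewrite tmapE //; last exact: (wcons_bilin V).2.
by rewrite tliftE // st_counit_cons scale0r.
Qed.

Lemma st_counitr x : tlift (fun x y => st_counit y *: x) (st_comul x) = x.
Proof.
have bl : bilin (fun x y : st V => st_counit y *: x).
  split=> [z a u w | u a z w].
    by rewrite scalerDr !scalerA mulrC.
  by rewrite st_counit_linear scalerDl scalerA.
have ll := tlift_linear bl; have cl := st_comul_linear.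
move: x; apply: st_eq => [|| s] //; first exact: linear_comp cl ll.
case/lastP: s => [|s v].
  by rewrite st_comul_nil tliftE // st_counitE scale1r.
rewrite -wrconsE st_comul_rcons (linD ll) tliftE // st_counitE scale1r.
rewrite -[RHS]add0r; congr (_ + _); move: (st_comul _).
have tW := tmap_linear (@idl (st V)) ((wrcons_bilin V).1 v).
apply: tensor_eq => [||x y]; first exact: linear_comp tW ll.
  by move=> a x y; rewrite scaler0 addr0.
rewrite tmapE //; last exact: (wrcons_bilin V).1.
by rewrite tliftE // st_counit_rcons scale0r.
Qed.

HB.instance Definition _ := isCoalgebra.Build k (st V)
  st_comul_linear st_counit_linear st_comulA st_counitl st_counitr.

End Deconcatenation.

Section TensorMul.
Variables (k : fieldType) (A B : assocAlgType k).

Lemma tmul_in_bilin (a : A) (b : B) : bilin (fun a' b' => (a ** a') \ox (b ** b')).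
Proof.
by apply: (bilin_pre (tpure_bilin _ _)); exact: amul_bilin.2.
Qed.

Lemma tmul_bilin : bilin (@tmul k A B).
Proof.
apply: bilin_flip; apply: (@tlift_param _ _ _ _ _ (fun t a b => tlift (fun a' b' => (a ** a') \ox (b ** b')) t)).
  move=> t; split=> [b | a].
    apply: (@tlift_param _ _ _ _ _ (fun a a' b' => (a ** a') \ox (b ** b')) _ _).1 => [a|a' b' c x y].
      exact: tmul_in_bilin.
    by rewrite amul_bilin.1 (tpure_bilin _ _).1.
  apply: (@tlift_param _ _ _ _ _ (fun b a' b' => (a ** a') \ox (b ** b')) _ _).1 => [b|a' b' c x y].
    exact: tmul_in_bilin.
  by rewrite amul_bilin.1 (tpure_bilin _ _).2.
by move=> a b; apply/tlift_linear/tmul_in_bilin.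
Qed.

Lemma tmulE (a a' : A) (b b' : B) :
  tmul (a \ox b) (a' \ox b') = (a ** a') \ox (b ** b').
Proof.
rewrite /tmul tliftE ?tliftE //; first exact: tmul_in_bilin.
split=> [c | c].
  apply: (@tlift_param _ _ _ _ _ (fun a a' b' => (a ** a') \ox (c ** b')) _ _).1 => [x|x y d u v].
    exact: tmul_in_bilin.
  by rewrite amul_bilin.1 (tpure_bilin _ _).1.
apply: (@tlift_param _ _ _ _ _ (fun b a' b' => (c ** a') \ox (b ** b')) _ _).1 => [x|x y d u v].
  exact: tmul_in_bilin.
by rewrite amul_bilin.1 (tpure_bilin _ _).2.
Qed.

End TensorMul.

Section StuffleBialgebra.
Variables (k : fieldType) (A : assocAlgType k).
Implicit Types (x y : st A) (s t : tensor (st A) (st A)).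

Local Notation R a := (tmap (@idfun (st A)) (fun y : st A => wrcons y a)).

Let E : st A := aone.
Let TL := (@tmul_bilin k (st A) (st A)).1.
Let TR := (@tmul_bilin k (st A) (st A)).2.

Lemma appr_linear (a : A) : linear (R a).
Proof. exact: tmap_linear (@idfun_linear k (st A)) ((wrcons_bilin A).1 a). Qed.

Lemma apprE (a : A) x y : R a (x \ox y) = x \ox wrcons y a.
Proof. exact: tmapE (@idfun_linear k (st A)) ((wrcons_bilin A).1 a). Qed.

Let Rl := appr_linear.

Lemma tmul_appr s t (a b : A) :
  tmul (R a s) (R b t) =
    R a (tmul s (R b t)) + R b (tmul (R a s) t) + R (a ** b) (tmul s t).
Proof.
move: s; apply: tensor_eq => [||x y].
- exact: linear_comp (Rl a) (TL _).
- apply: linear_add; first apply: linear_add.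
  + exact: linear_comp (TL _) (Rl a).
  + exact: linear_comp (linear_comp (Rl a) (TL _)) (Rl b).
  + exact: linear_comp (TL _) (Rl _).
move: t; apply: tensor_eq => [||x' y'].
- exact: linear_comp (Rl b) (TR _).
- apply: linear_add; first apply: linear_add.
  + exact: linear_comp (linear_comp (Rl b) (TR _)) (Rl a).
  + exact: linear_comp (TR _) (Rl b).
  + exact: linear_comp (TR _) (Rl _).
rewrite !apprE !tmulE !apprE -!(linD ((tpure_bilin _ _).2 _)); congr (_ \ox _).
exact: st_mul_rcons.
Qed.

Lemma tmul_appr1 s x (a : A) : tmul (R a s) (x \ox E) = R a (tmul s (x \ox E)).
Proof.
move: s; apply: tensor_eq => [||y z].
- exact: linear_comp (Rl a) (TL _).
- exact: linear_comp (TL _) (Rl a).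
by rewrite apprE !tmulE apprE !amul1r.
Qed.

Lemma tmul_1appr s x (a : A) : tmul (x \ox E) (R a s) = R a (tmul (x \ox E) s).
Proof.
move: s; apply: tensor_eq => [||y z].
- exact: linear_comp (Rl a) (TR _).
- exact: linear_comp (TR _) (Rl a).
by rewrite apprE !tmulE apprE !amul1l.
Qed.

Lemma st_comulM x y : comul (x ** y) = tmul (comul x) (comul y).
Proof.
have cl : linear (comul : st A -> _) by exact: comul_linear.
have ML := (@amul_bilin k (st A)).1; have MR := (@amul_bilin k (st A)).2.
move: x; apply: st_eq => [||s].
- exact: linear_comp (ML _) cl.
- exact: linear_comp cl (TL _).
move: y; apply: st_eq => [||t].
- exact: linear_comp (MR _) cl.
- exact: linear_comp cl (TR _).
have EE : comul E = E \ox E by exact: st_comul_nil.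
have T1l z : tmul (E \ox E) z = z.
  move: z; apply: tensor_eq => [||u v] //; by rewrite tmulE !amul1l.
have T1r z : tmul z (E \ox E) = z.
  move: z; apply: tensor_eq => [||u v] //; by rewrite tmulE !amul1r.
have [n] := ubnP (size s + size t).
elim: n s t => // n IH s t.
case/lastP: s => [|s a]; first by rewrite -[word [::]]/E EE amul1l T1l.
case/lastP: t => [|t b]; first by rewrite -[word [::]]/E EE amul1r T1r.
rewrite !size_rcons => lt_n.
have := IH s (rcons t b); have := IH (rcons s a) t; have := IH s t.
rewrite !size_rcons -!wrconsE.
move=> /(_ ltac:(lia)) I3 /(_ ltac:(lia)) I2 /(_ ltac:(lia)) I1.
have cr z c : comul (wrcons z c) = R c (comul z) + wrcons z c \ox E.
  exact: st_comul_rcons.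
have mr (z z' : st A) c c' : wrcons z c ** wrcons z' c' = wrcons (z ** wrcons z' c') c
    + wrcons (wrcons z c ** z') c' + wrcons (z ** z') (c ** c').
  exact: st_mul_rcons.
rewrite [in LHS]mr !(linD cl) !cr I1 I2 I3.
rewrite !(linD (TL _)) !(linD (TR _)) tmul_appr tmul_appr1 tmul_1appr tmulE amul1l mr.
rewrite !(linD ((tpure_bilin _ _).1 _)).
rewrite !cr !(linD (TL _)) !(linD (TR _)) !(linD (Rl _)).
by rewrite [LHS](AC (3*3*2) (1*4*7*2*(5*(3*6*8)))).
Qed.

Lemma st_comul1 : comul E = E \ox E.
Proof. exact: st_comul_nil. Qed.

Lemma st_counit1 : counit E = 1.
Proof. exact: st_counitE. Qed.

Lemma st_counitM x y : counit (x ** y) = counit x * counit y.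
Proof.
have cl : linear (counit : st A -> k^o) by exact: counit_linear.
have ML := (@amul_bilin k (st A)).1; have MR := (@amul_bilin k (st A)).2.
have mr (z z' : st A) c c' : wrcons z c ** wrcons z' c' = wrcons (z ** wrcons z' c') c
    + wrcons (wrcons z c ** z') c' + wrcons (z ** z') (c ** c').
  exact: st_mul_rcons.
have cr (z : st A) c : counit (wrcons z c) = 0 by exact: st_counit_rcons.
move: x; apply: (@st_eq _ _ k^o) => [||s].
- exact: linear_comp (ML _) cl.
- by move=> a u v; rewrite counit_linear mulrDl -mulrA.
move: y; apply: (@st_eq _ _ k^o) => [||t].
- exact: linear_comp (MR _) cl.
- by move=> a u v; rewrite counit_linear mulrDr mulrCA.
case/lastP: s => [|s a]; first by rewrite -[word [::]]/E st_counit1 amul1l mul1r.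
case/lastP: t => [|t b]; first by rewrite -[word [::]]/E st_counit1 amul1r mulr1.
by rewrite -!wrconsE mr !(linD cl) !cr !addr0 mul0r.
Qed.

HB.instance Definition _ :=
  isBialgebra.Build k (st A) st_comul1 st_comulM st_counit1 st_counitM.

End StuffleBialgebra.

Section Connected.
Variables (k : fieldType).

Record filtration (H : bialgType k) (F : nat -> {pred H}) : Prop := Filtration {
  filt_submod : forall n, submod_closed (F n);
  filt_sub : forall n, {subset F n <= F n.+1};
  filt_strict : forall n, exists2 x, x \in F n.+1 & x \notin F n;
  filt_exhaust : forall x, exists n, x \in F n;
  filt_comul : forall n x, x \in F n ->
    lspan (fun t => exists i y z,
            [/\ (i <= n)%N, y \in F i, z \in F (n - i)%N & t = y \ox z]) (comul x);
  filt_mul : forall n m x y, x \in F n -> y \in F m -> x ** y \in F (n + m)%N;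
}.

Definition connected_filtration (H : bialgType k) (F : nat -> {pred H}) : Prop :=
  filtration F /\ (forall x, x \in F 0%N <-> exists a : k, x = a *: aone).
End Connected.

HB.mixin Record isConnected (k : fieldType) H of Bialgebra k H := {
  connectedP : exists F : nat -> {pred H}, connected_filtration F
}.

#[short(type="connBialgType")]
HB.structure Definition ConnectedBialgebra (k : fieldType) :=
  {H of Bialgebra k H & isConnected k H}.

Section Augmentation.
Variables (k : fieldType) (H : bialgType k).

(* H' = ker counit; aug H is the corresponding subspace as a type. *)
Definition augker : {pred H} := fun h => counit h == 0.

Lemma augker_submod : submod_closed augker.
Proof.
split=> [|a x y /eqP x0 /eqP y0]; apply/eqP; first exact: linear0.
by rewrite counit_linear x0 y0 mulr0 addr0.
Qed.

HB.instance Definition _ := GRing.isSubmodClosed.Build k H augker augker_submod.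

Record aug := Aug { aug_val : H; _ : aug_val \in augker }.

HB.instance Definition _ := [isSub for aug_val].
HB.instance Definition _ := [Choice of aug by <:].
HB.instance Definition _ := [SubChoice_isSubLmodule of aug by <:].

Lemma counit_scale1 (a : k) : counit (a *: (aone : H)) = a.
Proof. by rewrite linearZ /= counit1 mulr1. Qed.

Lemma pprime_subproof (h : H) : h - counit h *: aone \in augker.
Proof. by apply/eqP; rewrite linearB /= counit_scale1 subrr. Qed.

(* p' = Id - u o eta, with codomain H'. *)
Definition pprime (h : H) : aug := Aug (pprime_subproof h).

Lemma pprime_linear : linear pprime.
Proof.
move=> a x y; apply: val_inj => /=.
by rewrite counit_linear scalerDl -scalerA opprD addrACA -scalerBr.
Qed.
HB.instance Definition _ := GRing.isLinear.Build k H aug *:%R pprime pprime_linear.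

(* icomul n is the iterated coproduct Delta^[n+1] : H -> H^{(x)(n+1)}, with the *)
(* target seen inside st H, and redcomul n is Delta'^[n+1].                    *)
Fixpoint icomul (n : nat) : H -> st H :=
  if n is m.+1 then fun h => tlift (fun x y => wcons x (icomul m y)) (comul h)
  else fun h => word [:: h].

Definition redcomul (n : nat) (h : aug) : st aug := wmap pprime (icomul n (val h)).

(* h = eta(h) 1 + p'(h) gives the decomposition H = k 1 (+) H'. The sum is the   *)
(* finitely supported sum over all n >= 0; its support is finite when H is      *)
(* connected (redcomul_eq0).                                                    *)
Definition iota_st (h : H) : st aug :=
  counit h *: word [::] + \sum_(n \in [set: nat]) redcomul n (pprime h).

Lemma icomul_bilin n : linear (icomul n) -> bilin (fun x y => wcons x (icomul n y)).
Proof. by move=> nl; apply: (bilin_pre (wcons_bilin H)). Qed.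

Lemma icomul_linear n : linear (icomul n).
Proof.
elim: n => [|n IH] /=; first exact: (word_multilin [::] [::]).
exact: linear_comp (@comul_linear _ H) (tlift_linear (icomul_bilin IH)).
Qed.

Lemma redcomul_linear n : linear (redcomul n).
Proof.
have wl : linear (wmap pprime) by exact: linearP.
have vl : linear (val : aug -> H) by exact: linearP.
exact: linear_comp (linear_comp vl (icomul_linear n)) wl.
Qed.

Lemma redcomul_eq0 F : connected_filtration F ->
  forall n m (h : aug), val h \in F n -> (n <= m)%N -> redcomul m h = 0.
Proof.
move=> [filtF F0] n m [h hh] /=; rewrite /redcomul /= => {hh}.
pose S m n (x : st H) := exists (d : seq nat) s,
  [/\ all2 (fun h i => h \in F i) s d, size s = m.+1, sumn d = n & x = word s].
have key : h \in F n -> lspan (S m n) (icomul m h).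
  elim: m n h => [|m IH] n h hn /=.
    by apply: lspan_gen; exists [:: n], [:: h]; rewrite /= hn addn0.
  have tl := tlift_linear (icomul_bilin (icomul_linear m)).
  elim: (filt_comul filtF hn) => [|a t u [i [y [z [le_in yi zi ->]]]] _ IHu].
    by rewrite (lin0 tl); exact: lspan0.
  rewrite tl tliftE; last exact/icomul_bilin/icomul_linear.
  apply: lspan_lin IHu; elim: (IH _ _ zi) => [|b v w [d [s [ds sm dn ->]]] _ IHw].
    by rewrite (lin0 ((wcons_bilin H).2 y)); exact: lspan0.
  rewrite (wcons_bilin H).2 wconsE; apply: lspanS IHw.
  by exists (i :: d), (y :: s); rewrite /= yi ds sm dn subnKC.
move=> hn le_nm; have wl : linear (wmap pprime) by exact: linearP.
elim: (key hn) => [|a x y [d [s [ds sm dn ->]]] _ IHy]; first exact: lin0.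
rewrite wl IHy addr0 /wmap wliftE; last exact/wmap_multilin/pprime_linear.
suff /hasP [z xs x0] : has (fun x => x \in F 0%N) s.
  have [s1 s2] := splitPr xs; rewrite map_cat /=.
  have -> : pprime z = 0; last by rewrite word0 scaler0.
  have [b ->] := (F0 z).1 x0; apply: val_inj => /=.
  by rewrite counit_scale1 subrr.
have : (sumn d < size s)%N by rewrite dn sm ltnS.
elim: s d ds {sm dn} => [|u s IHs] [|[|i] d] //= /andP[ui ds]; first by rewrite ui.
move=> lt; apply/orP; right; apply: IHs ds _; lia.
Qed.

End Augmentation.

Section Iota.
Variables (k : fieldType) (H : connBialgType k).

Lemma iota_stE (h : H) : exists N, forall M, (N <= M)%N ->
  iota_st h = counit h *: word [::] + \sum_(n < M) redcomul n (pprime h).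
Proof.
have [F cF] := @connectedP k H; have [fF _] := cF.
have [N hN] := filt_exhaust fF (val (pprime h)).
exists N => M le_NM; rewrite /iota_st; congr (_ + _).
rewrite (fsbig_ord _ M (fun n => redcomul n (pprime h))); apply/esym/fsbig_widen => // n /= [_ /negP].
by rewrite -leqNgt => le_Mn; apply: (redcomul_eq0 cF hN); lia.
Qed.

Lemma iota_st_linear : linear (@iota_st k H).
Proof.
have pl : linear (@pprime k H) by exact: linearP.
move=> a x y; have [N1 e1] := iota_stE (a *: x + y).
have [N2 e2] := iota_stE x; have [N3 e3] := iota_stE y.
rewrite (e1 (N1 + N2 + N3)%N) ?(e2 (N1 + N2 + N3)%N) ?(e3 (N1 + N2 + N3)%N); try lia.
rewrite counit_linear scalerDl -scalerA scalerDr addrACA; congr (_ + _).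
rewrite scaler_sumr -big_split; apply: eq_bigr => n _ /=.
by rewrite pl (redcomul_linear n).
Qed.
HB.instance Definition _ :=
  GRing.isLinear.Build k H (st (aug H)) *:%R (@iota_st k H) iota_st_linear.

End Iota.

Section Convolution.
Variables (k : fieldType).

Definition inU (K : bialgType k) (B : unitalAlgType k) (f : {linear K -> B}) : Prop :=
  f aone = aone.

Definition inC (K : bialgType k) (B : unitalAlgType k) (f : {linear K -> B}) : Prop :=
  inU f /\ {morph f : x y / x ** y >-> x ** y}.

Definition multT (B : assocAlgType k) : tensor B B -> B := tlift amul.

Definition convol (K : bialgType k) (B : unitalAlgType k) (f g : K -> B) : K -> B :=
  fun x => multT (tmap f g (comul x)).

Lemma convol_linear (K : bialgType k) (B : unitalAlgType k) (f g : {linear K -> B}) :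
  linear (convol f g).
Proof.
have fl : linear f by exact: linearP.
have gl : linear g by exact: linearP.
exact: linear_comp (linear_comp (@comul_linear _ K) (tmap_linear fl gl))
  (tlift_linear (@amul_bilin _ B)).
Qed.

HB.instance Definition _ (K : bialgType k) (B : unitalAlgType k) (f g : {linear K -> B}) :=
  GRing.isLinear.Build k K B *:%R (convol f g) (convol_linear f g).

Definition phist (H : bialgType k) (A : unitalAlgType k) (phi : H -> A) :
  st (aug H) -> st A := wmap (phi \o val).

HB.instance Definition _ (H : bialgType k) (A : unitalAlgType k) (phi : {linear H -> A}) :=
  GRing.Linear.copy (phist phi) (wmap (phi \o val)).

Definition Tmap (H : connBialgType k) (A B : unitalAlgType k)
    (f : st A -> B) (phi : H -> A) : H -> B := f \o phist phi \o (@iota_st k H).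

HB.instance Definition _ (H : connBialgType k) (A B : unitalAlgType k)
    (f : {linear st A -> B}) (phi : {linear H -> A}) :=
  GRing.Linear.copy (Tmap f phi) (f \o phist phi \o (@iota_st k H)).

Definition jmap (A : unitalAlgType k) : st A -> A :=
  wlift (fun s => match s with [::] => aone | [:: a] => a | _ => 0 end).

Lemma jmap_linear (A : unitalAlgType k) : linear (@jmap A).
Proof.
apply: wlift_linear => -[|c s] t a x y //=; first by case: t => [|d t]; rewrite ?scaler0 ?addr0.
by case: s => [|d s]; rewrite ?scaler0 ?addr0.
Qed.
HB.instance Definition _ (A : unitalAlgType k) :=
  GRing.isLinear.Build k (st A) A *:%R (@jmap A) (@jmap_linear A).

End Convolution.

(* Main.v *)
(* Let psi = phi^st o iota and q = phi o p'. Coassociativity turns the definition of iota into the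
   recursion psi(h) = eta(h) [] + sum psi(h_1) (x) q(h_2), which peels off the last letter, like the
   stuffle product. Since q(1) = 0, induction on the filtration shows that such a recursion has at
   most one solution. This gives Delta o psi = (psi (x) psi) o Delta, as both sides solve the same
   recursion, whence (ii). If phi is a character then
   q(xy) = q(x) q(y) + eta(y) q(x) + eta(x) q(y), which matches the three terms of the stuffle
   product, so that psi(xy) and psi(x) psi(y) solve the same recursion in two variables, whence (i).
   For (iii), j kills the words of length >= 2, so j o psi = eta 1 + q = phi. *)
Require Import Defs.
From mathcomp Require Import all_boot all_algebra.
From mathcomp Require Import boolp ssrAC zify.

Set Implicit Arguments.
Unset Strict Implicit.
Unset Printing Implicit Defensive.

Import GRing.Theory.
Local Open Scope ring_scope.

(** * Tensors as finite sums, and linear maps out of a tensor product *)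

Section TensorSums.
Variables (k : fieldType) (V W : lmodType k).

(** This stands in for Sweedler notation: a coproduct becomes a sum over a list of pairs, without
    coefficients. *)
Lemma tensor_sum (t : tensor V W) :
  exists r : seq (V * W), t = \sum_(p <- r) p.1 \ox p.2.
Proof.
elim/tensor_ind: t => [|v w t [r ->]]; first by exists [::]; rewrite big_nil.
by exists ((v, w) :: r); rewrite big_cons.
Qed.

Lemma tlift_sum (U : lmodType k) (b : V -> W -> U) (r : seq (V * W)) :
  bilin b -> tlift b (\sum_(p <- r) p.1 \ox p.2) = \sum_(p <- r) b p.1 p.2.
Proof.
move=> bb; rewrite (lin_sum (tlift_linear bb)).
by apply: eq_bigr => p _; rewrite tliftE.
Qed.

Lemma eq_tlift (U : lmodType k) (b c : V -> W -> U) : b =2 c -> tlift b =1 tlift c.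
Proof. by move=> e t; congr (tlift _ t); apply/funext => v; apply/funext => w. Qed.

Lemma lin_tlift (U X : lmodType k) (b : V -> W -> U) (f : U -> X) t :
  bilin b -> linear f -> f (tlift b t) = tlift (fun v w => f (b v w)) t.
Proof.
move=> bb fl; have [r ->] := tensor_sum t.
by rewrite !tlift_sum ?(lin_sum fl) //; exact: bilin_comp.
Qed.

Lemma tlift_tmap (V' W' U : lmodType k) (b : V' -> W' -> U) (f : V -> V') (g : W -> W') t :
  bilin b -> linear f -> linear g ->
  tlift b (tmap f g t) = tlift (fun v w => b (f v) (g w)) t.
Proof.
move=> bb fl gl; rewrite /tmap lin_tlift; [|exact: tmap_bilin|exact: tlift_linear].
by apply: eq_tlift => v w; rewrite tliftE.
Qed.

Lemma linear_scale (U : lmodType k) (e : V -> k) (u : U) :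
  scalar e -> linear (fun v => e v *: u).
Proof. by move=> el a x y; rewrite el scalerDl scalerA. Qed.

End TensorSums.

(** * Coassociativity and counit laws in summed form *)

Section Coassociativity.
Variables (k : fieldType) (C : coalgType k) (U : lmodType k).

(** Coassociativity tested against a trilinear [F], which avoids handling triple tensors and
    [tassoc] later on. *)
Lemma comul_coassoc (F : C -> C -> C -> U) (c : C) :
  (forall y z, linear (fun x => F x y z)) -> (forall x, bilin (F x)) ->
  tlift (fun x y => tlift (F x) (comul y)) (comul c) =
  tlift (fun x z => tlift (fun a b => F a b z) (comul x)) (comul c).
Proof.
move=> F1 F23; have cl := @comul_linear k C.
have idl := @idfun_linear k C.
have b1 : bilin (fun x t => tlift (F x) t) by apply: tlift_param.
have F12 z : bilin (fun a b => F a b z).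
  by split=> [b|a]; [exact: F1|exact: (F23 a).1].
have b2 : bilin (fun (t : tensor C C) z => tlift (fun a b => F a b z) t).
  apply: bilin_flip; apply: (@tlift_param _ _ _ _ _ (fun z a b => F a b z)) => // a b.
  exact: (F23 a).2.
have al := @tassoc_linear k C C C; have Tl := @tpure_bilin k (tensor C C) C.
(* Each side is a linear map applied to one side of [comulA]; what remains is an equality of two
   linear maps on (C ⊗ C) ⊗ C, checked on pure tensors. *)
rewrite -(tlift_tmap _ b1 idl cl) -(tlift_tmap _ b2 cl idl) -comulA.
move: (tmap comul idfun _); apply: tensor_eq => [||t z].
- apply: linear_comp al _; exact: tlift_linear.
- exact: tlift_linear.
rewrite [RHS]tliftE //; move: t; apply: tensor_eq => [||x y].
- exact: linear_comp (linear_comp (Tl.1 z) al) (tlift_linear b1).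
- exact: tlift_linear.
by rewrite tassocE !tliftE.
Qed.

Lemma comul_coassoc_sum (F : C -> C -> C -> U) (c : C) (r : seq (C * C)) :
  (forall y z, linear (fun x => F x y z)) -> (forall x, bilin (F x)) ->
  comul c = \sum_(p <- r) p.1 \ox p.2 ->
  \sum_(p <- r) tlift (F p.1) (comul p.2) =
  \sum_(p <- r) tlift (fun a b => F a b p.2) (comul p.1).
Proof.
move=> F1 F23 cr; have cl := @comul_linear k C.
have F12 z : bilin (fun a b => F a b z).
  by split=> [b|a]; [exact: F1|exact: (F23 a).1].
have b1 : bilin (fun x t => tlift (F x) t) by apply: tlift_param.
have b2 : bilin (fun z t => tlift (fun a b => F a b z) t).
  apply: (@tlift_param _ _ _ _ _ (fun z a b => F a b z)) => // a b; exact: (F23 a).2.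
have := comul_coassoc c F1 F23; rewrite cr !tlift_sum //.
  exact: (bilin_flip (bilin_pre b2 (@idfun_linear k C) cl)).
exact: (bilin_pre b1 (@idfun_linear k C) cl).
Qed.

Lemma counitl_sum (f : C -> U) c (r : seq (C * C)) : linear f ->
  comul c = \sum_(p <- r) p.1 \ox p.2 -> f c = \sum_(p <- r) counit p.1 *: f p.2.
Proof.
move=> fl cr; rewrite -{1}[c]counitl cr tlift_sum; last first.
  by split=> [y|x] a u v; rewrite ?counit_linear ?scalerDl ?scalerA // scalerDr !scalerA mulrC.
by rewrite (lin_sum fl); apply: eq_bigr => p _; rewrite (linZ fl).
Qed.

Lemma counitr_sum (f : C -> U) c (r : seq (C * C)) : linear f ->
  comul c = \sum_(p <- r) p.1 \ox p.2 -> f c = \sum_(p <- r) counit p.2 *: f p.1.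
Proof.
move=> fl cr; rewrite -{1}[c]counitr cr tlift_sum; last first.
  by split=> [y|x] a u v; rewrite ?counit_linear ?scalerDl ?scalerA // scalerDr !scalerA mulrC.
by rewrite (lin_sum fl); apply: eq_bigr => p _; rewrite (linZ fl).
Qed.

End Coassociativity.

(** * Uniqueness for convolution recursions, by induction on the filtration *)

Section ConnectedInduction.
Variables (k : fieldType) (H : connBialgType k).
Variables (U W : lmodType k) (op : U -> W -> U) (q : H -> W).
Hypotheses (op_bilin : bilin op) (q_linear : linear q) (q1 : q aone = 0).

Lemma filt_comul_sum (F : nat -> {pred H}) n x : filtration F -> x \in F n ->
  exists2 r : seq (H * H),
    (forall p, p \in r -> exists2 i, (i <= n)%N & p.1 \in F i /\ p.2 \in F (n - i)%N)
  & comul x = \sum_(p <- r) p.1 \ox p.2.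
Proof.
move=> fF xn; elim: (filt_comul fF xn) => [|a _ t [i [y [z [le_in yi zi ->]]]] _ [r Pr ->]].
  by exists [::] => //; rewrite big_nil.
(* The coefficient goes into the left factor, which stays in [F i] because [F i] is a subspace. *)
exists ((a *: y, z) :: r) => [p|]; last first.
  by rewrite big_cons /= (linZ ((tpure_bilin _ _).1 z)).
rewrite inE => /orP[/eqP -> /=|/Pr //]; exists i => //; split=> //.
have [F0 FZ] := filt_submod fF i; rewrite -[_ *: _]addr0; exact: FZ.
Qed.

(** The recursions are assumed for every decomposition [r] of the coproduct, so that one adapted to
    the filtration can be chosen. Terms whose left factor has lower degree agree by induction; the
    others vanish. *)
Lemma conv_fixpoint_eq (e E E' : H -> U) :
  (forall h r, comul h = \sum_(p <- r) p.1 \ox p.2 ->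
     E h = e h + \sum_(p <- r) op (E p.1) (q p.2)) ->
  (forall h r, comul h = \sum_(p <- r) p.1 \ox p.2 ->
     E' h = e h + \sum_(p <- r) op (E' p.1) (q p.2)) ->
  E =1 E'.
Proof.
have [F [fF F0]] := @connectedP k H => Erec E'rec h.
have [n] := filt_exhaust fF h; elim/ltn_ind: n h => n IH h hn.
have [r Pr cr] := filt_comul_sum fF hn.
rewrite (Erec _ _ cr) (E'rec _ _ cr); congr (_ + _).
apply: eq_big_seq => p /Pr [i le_in [p1 p2]].
have [lt_in|ge_in] := ltnP i n; first by rewrite (IH i).
(* Now i = n, so [p.2] is a multiple of the unit and is killed by [q]. *)
move: p2; have -> : (n - i = 0)%N by lia.
by move=> /F0 [a ->]; rewrite (linZ q_linear) q1 scaler0 !(lin0 (op_bilin.2 _)).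
Qed.

(** The same argument in two variables, by induction on the sum of the two filtration degrees. *)
Lemma conv_fixpoint2_eq (e D D' : H -> H -> U) :
  (forall x y r s, comul x = \sum_(p <- r) p.1 \ox p.2 ->
     comul y = \sum_(p <- s) p.1 \ox p.2 ->
     D x y = e x y + \sum_(p <- r) \sum_(p' <- s) op (D p.1 p'.1) (q (p.2 ** p'.2))) ->
  (forall x y r s, comul x = \sum_(p <- r) p.1 \ox p.2 ->
     comul y = \sum_(p <- s) p.1 \ox p.2 ->
     D' x y = e x y + \sum_(p <- r) \sum_(p' <- s) op (D' p.1 p'.1) (q (p.2 ** p'.2))) ->
  D =2 D'.
Proof.
have [F [fF F0]] := @connectedP k H => Drec D'rec x y.
have [n] := filt_exhaust fF x; have [m] := filt_exhaust fF y.
have [N] := ubnP (n + m); elim: N n m x y => // N IH n m x y lt_N ym xn.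
have [r Pr cr] := filt_comul_sum fF xn; have [s Ps cs] := filt_comul_sum fF ym.
rewrite (Drec _ _ _ _ cr cs) (D'rec _ _ _ _ cr cs); congr (_ + _).
apply: eq_big_seq => p /Pr [i le_in [p1 p2]].
apply: eq_big_seq => p' /Ps [j le_jm [p'1 p'2]].
have [lt_ij|ge_ij] := ltnP (i + j) (n + m).
  by rewrite (IH i j _ _ _ p'1 p1) //; lia.
(* No drop in total degree forces i = n and j = m: both right factors are scalars, hence so is their
   product, and [q] kills it. *)
move: p2 p'2; have -> : (n - i = 0)%N by lia.
have -> : (m - j = 0)%N by lia.
move=> /F0 [a ->] /F0 [b ->].
rewrite (linZ (amul_bilin.1 _)) (linZ (amul_bilin.2 _)) amul1l.
by rewrite !(linZ q_linear) q1 !scaler0 !(lin0 (op_bilin.2 _)).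
Qed.

End ConnectedInduction.

(** * Multiplicativity of solutions of stuffle-type recursions *)

Section StuffleRecursion.
Variables (k : fieldType) (H : connBialgType k).
Variables (U : unitalAlgType k) (W : assocAlgType k).
Variables (op : U -> W -> U) (psi : H -> U) (q : H -> W).
Hypotheses (op_bilin : bilin op) (psi_linear : linear psi) (q_linear : linear q).
Hypothesis op_mul : forall z z' c c', op z c ** op z' c' =
  op (z ** op z' c') c + op (op z c ** z') c' + op (z ** z') (c ** c').
Hypothesis q1 : q aone = 0.
Hypothesis qM : forall u v, q (u ** v) = counit v *: q u + counit u *: q v + q u ** q v.
Hypothesis psi_rec : forall h r, comul h = \sum_(p <- r) p.1 \ox p.2 ->
  psi h = counit h *: aone + \sum_(p <- r) op (psi p.1) (q p.2).

Let ML := (@amul_bilin k U).1.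
Let MR := (@amul_bilin k U).2.
Let WL := op_bilin.1.
Let WR := op_bilin.2.

(** The model for [U], [W], [op] is [st A], [A], [wrcons], where [op_mul] is the stuffle recursion.
    Here the recursion for [psi] is applied at a product, whose coproduct is the product of the
    coproducts. *)
Lemma stuffle_rec_comulM (x y : H) (r s : seq (H * H)) :
  comul x = \sum_(p <- r) p.1 \ox p.2 -> comul y = \sum_(p <- s) p.1 \ox p.2 ->
  psi (x ** y) = counit (x ** y) *: aone +
    \sum_(p <- r) \sum_(p' <- s) op (psi (p.1 ** p'.1)) (q (p.2 ** p'.2)).
Proof.
move=> cr cs; have bb : bilin (fun x y => op (psi x) (q y)) by apply: bilin_pre.
have tl := tlift_linear bb.
(* Written with [tlift], the recursion no longer depends on a decomposition, so the double sum
   coming from [comulM] can be substituted. *)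
have -> : psi (x ** y) =
    counit (x ** y) *: aone + tlift (fun x y => op (psi x) (q y)) (comul (x ** y)).
  by have [t ct] := tensor_sum (comul (x ** y)); rewrite (psi_rec ct) ct tlift_sum.
rewrite comulM cr cs; congr (_ + _).
rewrite (lin_sum ((@tmul_bilin k H H).1 _)) (lin_sum tl); apply: eq_bigr => p _.
rewrite (lin_sum ((@tmul_bilin k H H).2 _)) (lin_sum tl); apply: eq_bigr => p' _.
by rewrite tmulE tliftE.
Qed.

(** The product of the recursions for [psi x] and [psi y] is expanded by [op_mul], the right-hand
    side by [qM]; the three terms of each match after contraction with the counit. *)
Lemma stuffle_rec_mul (x y : H) (r s : seq (H * H)) :
  comul x = \sum_(p <- r) p.1 \ox p.2 -> comul y = \sum_(p <- s) p.1 \ox p.2 ->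
  psi x ** psi y = counit (x ** y) *: aone +
    \sum_(p <- r) \sum_(p' <- s) op (psi p.1 ** psi p'.1) (q (p.2 ** p'.2)).
Proof.
move=> cr cs; have er := psi_rec cr; have es := psi_rec cs.
set X := \sum_(p <- r) op _ _ in er; set Y := \sum_(p <- s) op _ _ in es.
pose S1 := \sum_(p <- r) \sum_(p' <- s) op (psi p.1 ** op (psi p'.1) (q p'.2)) (q p.2).
pose S2 := \sum_(p <- r) \sum_(p' <- s) op (op (psi p.1) (q p.2) ** psi p'.1) (q p'.2).
pose S3 := \sum_(p <- r) \sum_(p' <- s) op (psi p.1 ** psi p'.1) (q p.2 ** q p'.2).
(* The counit contracts the sum over [s] to [psi y], which is then expanded again by its own
   recursion; [L2] does the same for [x]. *)
have L1 : \sum_(p <- r) \sum_(p' <- s) op (psi p.1 ** psi p'.1) (counit p'.2 *: q p.2)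
    = counit y *: X + S1.
  rewrite scaler_sumr -big_split; apply: eq_bigr => p _ /=.
  have fl : linear (fun z => op (psi p.1 ** psi z) (q p.2)).
    exact: linear_comp (linear_comp psi_linear (MR _)) (WL _).
  under eq_bigr => p' _ do rewrite (linZ (WR _)).
  rewrite -(counitr_sum fl cs) es (linD (MR _)) (linZ (MR _)) (lin_sum (MR _)).
  by rewrite amul1r (linD (WL _)) (linZ (WL _)) (lin_sum (WL _)).
have L2 : \sum_(p <- r) \sum_(p' <- s) op (psi p.1 ** psi p'.1) (counit p.2 *: q p'.2)
    = counit x *: Y + S2.
  rewrite /S2 exchange_big [X in _ + X]exchange_big scaler_sumr -big_split.
  apply: eq_bigr => p _ /=.
  have fl : linear (fun z => op (psi z ** psi p.1) (q p.2)).
    exact: linear_comp (linear_comp psi_linear (ML _)) (WL _).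
  under eq_bigr => p' _ do rewrite (linZ (WR _)).
  rewrite -(counitr_sum fl cr) er (linD (ML _)) (linZ (ML _)) (lin_sum (ML _)).
  by rewrite amul1l (linD (WL _)) (linZ (WL _)) (lin_sum (WL _)).
have XY : X ** Y = S1 + S2 + S3.
  rewrite (lin_sum (ML _)) -!big_split; apply: eq_bigr => p _ /=.
  rewrite (lin_sum (MR _)) -!big_split; apply: eq_bigr => p' _ /=.
  exact: op_mul.
have -> : \sum_(p <- r) \sum_(p' <- s) op (psi p.1 ** psi p'.1) (q (p.2 ** p'.2))
    = (counit y *: X + S1) + (counit x *: Y + S2) + S3.
  rewrite -L1 -L2 -!big_split; apply: eq_bigr => p _ /=.
  rewrite -!big_split; apply: eq_bigr => p' _ /=.
  by rewrite qM !(linD (WR _)).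
rewrite er es (linD (ML _)) (linZ (ML _)) amul1l !(linD (MR _)) (linZ (MR _)) amul1r XY.
rewrite counitM scalerDr scalerA -!addrA; congr (_ + _).
rewrite [LHS](AC (1*(1*(1*(1*1)))) (2*(3*(1*(4*5))))); congr (_ + (_ + _)).
Qed.

Lemma stuffle_rec_morph : {morph psi : x y / x ** y >-> x ** y}.
Proof.
exact: (conv_fixpoint2_eq op_bilin q_linear q1 (D := fun x y => psi (x ** y))
  (D' := fun x y => psi x ** psi y) stuffle_rec_comulM stuffle_rec_mul).
Qed.

End StuffleRecursion.

(** * The last-letter recursion for iota *)

Section IotaRecursion.
Variables (k : fieldType).

Lemma wcons_wrcons (V : lmodType k) (v w : V) x :
  wcons v (wrcons x w) = wrcons (wcons v x) w.
Proof.
have Wc := (wcons_bilin V).2 v; have Wr := (wrcons_bilin V).1 w.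
move: x; apply: st_eq => [||s]; [exact: linear_comp Wr Wc|exact: linear_comp Wc Wr|].
by rewrite wrconsE !wconsE wrconsE.
Qed.

Lemma wmapE (V W : lmodType k) (f : V -> W) s :
  linear f -> wmap f (word s) = word (map f s).
Proof. by move=> fl; rewrite /wmap wliftE //; exact: wmap_multilin. Qed.

Lemma wmap_linear (V W : lmodType k) (f : V -> W) : linear f -> linear (wmap f).
Proof. by move=> fl; apply/wlift_linear/wmap_multilin. Qed.

Lemma wmap_wrcons (V W : lmodType k) (f : V -> W) x v :
  linear f -> wmap f (wrcons x v) = wrcons (wmap f x) (f v).
Proof.
move=> fl; have wl := wmap_linear fl.
move: x; apply: st_eq => [||s].
- exact: linear_comp ((wrcons_bilin V).1 v) wl.
- exact: linear_comp wl ((wrcons_bilin W).1 _).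
by rewrite wrconsE !wmapE // wrconsE map_rcons.
Qed.

(** The definition of [icomul] splits off the first letter; coassociativity moves the splitting to
    the last one. *)
Lemma icomul_rcons (H : bialgType k) n (h : H) :
  icomul n.+1 h = tlift (fun x y => wrcons (icomul n x) y) (comul h).
Proof.
have bw m : bilin (fun x y : H => wrcons (icomul m x) y).
  by apply: (bilin_pre (wrcons_bilin H)) => //; exact: icomul_linear.
have bc m : bilin (fun x y : H => wcons x (icomul m y)).
  exact/icomul_bilin/icomul_linear.
elim: n h => [|n IH] h; first by apply: eq_tlift => x y; rewrite wconsE wrconsE.
pose F (x y z : H) := wcons x (wrcons (icomul n y) z).
have F1 y z : linear (fun x => F x y z) by exact: (wcons_bilin H).1.
have F23 x : bilin (F x) by apply: bilin_comp (bw n) _; exact: (wcons_bilin H).2.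
transitivity (tlift (fun x y => tlift (F x) (comul y)) (comul h)).
  apply: eq_tlift => x y; rewrite -[LHS]/(wcons x (icomul n.+1 y)) IH.
  by rewrite (lin_tlift _ (bw n) ((wcons_bilin H).2 x)).
rewrite comul_coassoc //; apply: eq_tlift => x z.
rewrite /= (lin_tlift _ (bc n) ((wrcons_bilin H).1 z)).
by apply: eq_tlift => a b; rewrite /F wcons_wrcons.
Qed.

Lemma wmap_icomul1 (H : bialgType k) n : wmap (@pprime k H) (icomul n aone) = 0.
Proof.
have p1 : pprime (aone : H) = 0.
  by apply: val_inj => /=; rewrite counit1 scale1r subrr.
have -> : icomul n (aone : H) = word (nseq n.+1 aone).
  elim: n => [|n IH] //=; rewrite comul1 tliftE ?IH ?wconsE //.
  exact/icomul_bilin/icomul_linear.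
rewrite wmapE; last exact: pprime_linear.
by rewrite /= p1; exact: (word0 [::]).
Qed.

(** An element and its projection to the augmentation ideal differ by a multiple of the unit, whose
    iterated coproducts have only unit letters and are killed by p'. *)
Lemma redcomul_pprime (H : bialgType k) n (h : H) :
  redcomul n (pprime h) = wmap (@pprime k H) (icomul n h).
Proof.
have wl := linear_comp (@icomul_linear k H n) (wmap_linear (@pprime_linear k H)).
rewrite /redcomul /= -[- _]scaleN1r addrC.
by rewrite (linD wl) !(linZ wl) wmap_icomul1 !scaler0 add0r.
Qed.

Lemma iota_rcons (H : connBialgType k) (h : H) (r : seq (H * H)) :
  comul h = \sum_(p <- r) p.1 \ox p.2 ->
  iota_st h = counit h *: word [::] + \sum_(p <- r) wrcons (iota_st p.1) (pprime p.2).
Proof.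
move=> cr; have pl := @pprime_linear k H.
have [N1 e1] := iota_stE h.
(* The list [r] is finite, so one truncation bound serves all its left factors. *)
have [N2 e2] : exists N, forall M, (N <= M)%N -> forall p, p \in r ->
    iota_st p.1 = counit p.1 *: word [::] + \sum_(n < M) redcomul n (pprime p.1).
  elim: r {cr} => [|p r [N IH]]; first by exists 0%N.
  have [N' e] := iota_stE p.1; exists (N + N')%N => M le_M p'.
  by rewrite inE => /orP[/eqP ->|]; [apply: e|apply: IH]; lia.
(* Removing the term n = 0 leaves N1 + N2 terms, the truncation used for the left factors below. *)
rewrite (e1 (N1 + N2).+1) ?big_ord_recl /=; last by lia.
congr (_ + _).
(* By the left counit law, the one-letter term supplies the empty-word parts of the
   [iota_st p.1]. *)
have -> : redcomul 0 (pprime h) =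
    \sum_(p <- r) wrcons (counit p.1 *: word [::]) (pprime p.2).
  rewrite redcomul_pprime wmapE //= .
  have wl : linear (fun x : H => word [:: pprime x]).
    exact: linear_comp pl (word_multilin [::] [::]).
  rewrite (counitl_sum wl cr); apply: eq_bigr => p _.
  by rewrite (linZ ((wrcons_bilin _).1 _)) wrconsE.
(* The term of length n + 2 becomes the terms of length n + 1 of the left factors, each followed by
   one letter. *)
under [X in _ + X]eq_bigr => n _.
  rewrite redcomul_pprime -[bump 0 n]/(n.+1) icomul_rcons cr tlift_sum; last first.
    by apply: (bilin_pre (wrcons_bilin H)) => //; exact: icomul_linear.
  rewrite (lin_sum (wmap_linear pl)).
  under eq_bigr => p _ do rewrite wmap_wrcons // -redcomul_pprime.
  over.
rewrite exchange_big -big_split /= big_seq [RHS]big_seq.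
apply: eq_bigr => p pr; rewrite (e2 (N1 + N2)%N) //; last by lia.
by rewrite (linD ((wrcons_bilin _).1 _)) (lin_sum ((wrcons_bilin _).1 _)).
Qed.

End IotaRecursion.

Lemma jmap_multilin (k : fieldType) (A : unitalAlgType k) :
  multilin (fun s : seq A => match s with [::] => aone | [:: a] => a | _ => 0 end).
Proof.
move=> [|c s] t a x y /=; first by case: t => [|d t]; rewrite ?scaler0 ?addr0.
by case: s => [|d s]; rewrite ?scaler0 ?addr0.
Qed.

(** * The map psi as a bialgebra morphism, and its composite with j *)

Section StuffleLift.
Variables (k : fieldType) (H : connBialgType k) (A : unitalAlgType k).
Variable phi : {linear H -> A}.

Definition stlift (h : H) : st A := phist phi (iota_st h).
Definition redphi (h : H) : A := phi (val (pprime h)).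

Local Notation psi := stlift.
Local Notation q := redphi.

Lemma stlift_linear : linear stlift.
Proof.
have pl : linear (phist phi) by exact: linearP.
exact: linear_comp (@iota_st_linear k H) pl.
Qed.

Lemma redphi_linear : linear redphi.
Proof.
have pl : linear phi by exact: linearP.
have vl : linear (val : aug H -> H) by exact: linearP.
exact: linear_comp (@pprime_linear k H) (linear_comp vl pl).
Qed.

Lemma redphi1 : redphi aone = 0.
Proof. by rewrite /redphi /= counit1 scale1r subrr linear0. Qed.

Lemma stlift_rcons h (r : seq (H * H)) :
  comul h = \sum_(p <- r) p.1 \ox p.2 ->
  psi h = counit h *: word [::] + \sum_(p <- r) wrcons (psi p.1) (q p.2).
Proof.
move=> cr; have pl : linear (phist phi) by exact: linearP.
have fl : linear (phi \o (val : aug H -> H)) by exact: linearP.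
rewrite /stlift (iota_rcons cr) (linD pl) (linZ pl) (lin_sum pl).
rewrite [phist phi (word _)]wmapE //; congr (_ + _).
by apply: eq_bigr => p _; rewrite /phist wmap_wrcons.
Qed.

Lemma stlift_bilin : bilin (fun x y => wrcons (psi x) (q y)).
Proof.
by apply: (bilin_pre (wrcons_bilin A)); [exact: stlift_linear|exact: redphi_linear].
Qed.

Lemma stlift_tlift h :
  psi h = counit h *: word [::] + tlift (fun x y => wrcons (psi x) (q y)) (comul h).
Proof.
have [r cr] := tensor_sum (comul h).
by rewrite (stlift_rcons cr) cr tlift_sum //; exact: stlift_bilin.
Qed.

Lemma stlift1 : psi aone = word [::].
Proof.
rewrite (@stlift_rcons _ [:: (aone, aone)]); last by rewrite big_seq1 comul1.
by rewrite big_seq1 /= redphi1 counit1 scale1r (lin0 ((wrcons_bilin _).2 _)) addr0.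
Qed.

Local Notation R := (fun t v => tmap (@idfun (st A)) (fun y : st A => wrcons y v) t).

Lemma tmap_wrcons_bilin : bilin R.
Proof.
have Wb := wrcons_bilin A; have T := @tpure_bilin k (st A) (st A).
apply: bilin_flip; apply: (@tlift_param _ _ _ _ _ (fun v x y => x \ox wrcons y v)).
  by move=> v; exact: (bilin_pre T (@idfun_linear k (st A)) (Wb.1 v)).
by move=> x y; exact: linear_comp (Wb.2 y) (T.2 x).
Qed.

(** The recursion for [psi] is expanded in the second tensor factor. Its counit term contracts to
    [psi h \ox word [::]]; coassociativity regroups the rest, with the last letter appended to the
    second factor. *)
Lemma tmap_stlift_rcons h (r : seq (H * H)) :
  comul h = \sum_(p <- r) p.1 \ox p.2 ->
  tmap psi psi (comul h) = psi h \ox word [::]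
    + \sum_(p <- r) R (tmap psi psi (comul p.1)) (q p.2).
Proof.
move=> cr; have T := @tpure_bilin k (st A) (st A); have pl := stlift_linear.
have bT := tmap_bilin pl pl; have bS := stlift_bilin.
pose F x y z : tensor (st A) (st A) := psi x \ox wrcons (psi y) (q z).
have F1 y z : linear (fun x => F x y z) by exact: linear_comp pl (T.1 _).
have F23 x : bilin (F x) by apply: bilin_comp bS (T.2 _).
rewrite [in LHS]cr [LHS]tlift_sum //.
under eq_bigr => p _ do
  rewrite (stlift_tlift p.2) (linD (T.2 _)) (linZ (T.2 _)) (lin_tlift _ bS (T.2 _)).
rewrite big_split /= -(counitr_sum (linear_comp pl (T.1 (word [::]))) cr); congr (_ + _).
rewrite (comul_coassoc_sum F1 F23 cr); apply: eq_bigr => p _.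
apply: (etrans _ (esym (lin_tlift _ bT (tmap_wrcons_bilin.1 (q p.2))))).
by apply: eq_tlift => x y; rewrite tmapE //; exact: (wrcons_bilin A).1.
Qed.

(** Pushes the recursion for [psi] through a linear map [c]. With [c] the deconcatenation and [e]
    tensoring by the empty word, it yields the recursion of [tmap_stlift_rcons]. *)
Lemma lin_stlift_rcons (U : lmodType k) (c e : st A -> U) (op : U -> A -> U) :
  linear c -> linear e -> c (word [::]) = e (word [::]) ->
  (forall z v, c (wrcons z v) = op (c z) v + e (wrcons z v)) ->
  forall h r, comul h = \sum_(p <- r) p.1 \ox p.2 ->
  c (psi h) = e (psi h) + \sum_(p <- r) op (c (psi p.1)) (q p.2).
Proof.
move=> cl el ce crec h r /stlift_rcons; move: (psi h) => z ->.
rewrite (linD cl) (linD el) (linZ cl) (linZ el) ce (lin_sum cl) (lin_sum el).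
rewrite -addrA -big_split; congr (_ + _); apply: eq_bigr => p _.
by rewrite crec addrC.
Qed.

Lemma stlift_comul h : comul (psi h) = tmap psi psi (comul h).
Proof.
have T := @tpure_bilin k (st A) (st A).
have cl : linear (comul : st A -> _) by exact: comul_linear.
have crec := lin_stlift_rcons (op := R) cl (T.1 _) (@st_comul_nil k A)
  (fun z v => @st_comul_rcons k A z v).
exact: (conv_fixpoint_eq tmap_wrcons_bilin redphi_linear redphi1 crec tmap_stlift_rcons).
Qed.

Lemma stlift_counit h : counit (psi h) = counit h.
Proof.
have [r cr] := tensor_sum (comul h); have cl := @counit_linear k (st A).
have c1 : counit (word [::] : st A) = 1 by exact: st_counitE.
have c0 (z : st A) v : counit (wrcons z v) = 0 by exact: st_counit_rcons.
by rewrite (stlift_rcons cr) linearD linearZ linear_sum /= c1 mulr1 big1 ?addr0.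
Qed.

Lemma jmap_nil : jmap (word [::] : st A) = aone.
Proof. by rewrite /jmap wliftE //; exact: jmap_multilin. Qed.

(** Only the empty-word component of [z] gives a one-letter word, and [counit] reads off its
    coefficient. *)
Lemma jmap_wrcons (z : st A) v : jmap (wrcons z v) = counit z *: v.
Proof.
have jl := @jmap_linear k A.
move: z; apply: st_eq => [||s].
- exact: linear_comp ((wrcons_bilin A).1 v) jl.
- exact/linear_scale/counit_linear.
rewrite wrconsE /jmap wliftE; last exact: jmap_multilin.
have -> : counit (word s : st A) = (s == [::])%:R by exact: st_counitE.
by case: s => [|a [|b s]] /=; rewrite ?scale1r ?scale0r.
Qed.

Lemma jmap_stlift h : jmap (psi h) = counit h *: aone + q h.
Proof.
have jl := @jmap_linear k A; have [r cr] := tensor_sum (comul h).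
rewrite (stlift_rcons cr) (linD jl) (linZ jl) (lin_sum jl) jmap_nil; congr (_ + _).
(* Since [psi] preserves the counit, the left counit law collapses the sum to [q h]. *)
rewrite (counitl_sum redphi_linear cr); apply: eq_bigr => p _.
by rewrite jmap_wrcons stlift_counit.
Qed.

Hypotheses (phi1 : phi aone = aone) (phiM : {morph phi : x y / x ** y >-> x ** y}).

Lemma redphiK w : counit w *: aone + q w = phi w.
Proof. by rewrite /redphi /= linearB linearZ /= phi1 addrC subrK. Qed.

(** Adding [counit (u ** v) *: aone] to both sides turns the claim into the multiplicativity of
    [phi], expanded by [redphiK]. *)
Lemma redphiM u v :
  q (u ** v) = counit v *: q u + counit u *: q v + q u ** q v.
Proof.
have ML := (@amul_bilin k A).1; have MR := (@amul_bilin k A).2.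
apply: (addrI (counit (u ** v) *: aone)).
rewrite redphiK phiM counitM -!redphiK.
rewrite (linD (ML _)) (linZ (ML _)) amul1l !(linD (MR _)) (linZ (MR _)) amul1r.
by rewrite scalerDr scalerA -!addrA; congr (_ + _); rewrite addrCA.
Qed.

Lemma stliftM x y : psi (x ** y) = psi x ** psi y.
Proof.
apply: (stuffle_rec_morph (wrcons_bilin A) stlift_linear redphi_linear _ redphi1 redphiM).
  exact: st_mul_rcons.
exact: stlift_rcons.
Qed.

End StuffleLift.

Theorem mainTheorem3 (k : fieldType) (H : connBialgType k) (A B : unitalAlgType k) :
  [/\ forall (f : {linear st A -> B}) (phi : {linear H -> A}),
        inU f -> inU phi ->
        inU (Tmap f phi) /\ (inC phi -> inC f -> inC (Tmap f phi)),
      forall (f g : {linear st A -> B}) (phi : {linear H -> A}),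
        inU f -> inU g -> inU phi ->
        Tmap (convol f g) phi =1 convol (Tmap f phi) (Tmap g phi)
    & forall phi : {linear H -> A},
        inU phi -> Tmap (@jmap k A) phi =1 phi].
Proof.
split=> [f phi f1 phi1|f g phi f1 g1 phi1 h|phi phi1 h].
- have T1 : inU (Tmap f phi) by rewrite /inU -[LHS]/(f (stlift phi aone)) stlift1.
  split=> // -[_ phiM] [_ fM]; split=> // x y.
  rewrite -[LHS]/(f (stlift phi (x ** y))) stliftM //; exact: fM.
- have pl := stlift_linear phi; have fl : linear f by exact: linearP.
  have gl : linear g by exact: linearP.
  (* Convolution on [st A] uses deconcatenation, which [psi] intertwines with the coproduct of
     [H]. *)
  rewrite -[LHS]/(multT (tmap f g (comul (stlift phi h)))) stlift_comul.
  congr multT; exact: (tlift_tmap _ (tmap_bilin fl gl) pl pl).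
- rewrite -[LHS]/(jmap (stlift phi h)) jmap_stlift.
  exact: redphiK.
Qed.
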